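(* Let $\alpha>0$, $1\le p\le\infty$, and let $\varphi(z)=a+\lambda z$ with $a,\lambda\in\mathbb{C}$, $|\lambda|<1$. Put $\beta=1-|\lambda|^2$. Let $\psi$ be an entire function, not identically zero, and let $W_{\psi,\varphi}f=\psi\cdot(f\circ\varphi)$. (i) If $\psi$ has order strictly less than $2$, or if $\psi$ has order $2$ and type strictly less than $\alpha\beta/2$, then $W_{\psi,\varphi}$ is a compact weighted composition operator on $\mathcal{F}^p_\alpha$ and on $\mathcal{F}^\infty_{\alpha,0}$. (ii) If $\psi$ has order greater than $2$, or if $\psi$ has order $2$ and type strictly greater than $\alpha\beta/2$, then $W_{\psi,\varphi}$ is neither bounded on $\mathcal{F}^p_\alpha$ nor on $\mathcal{F}^\infty_{\alpha,0}$.
   Context: For $\alpha>0$ and $1\le p<\infty$, the Fock space $\mathcal{F}^p_\alpha$ is the Banach space of entire functions $f:\mathbb{C}\to\mathbb{C}$ with finite norm $\|f\|=\left(\frac{\alpha p}{2\pi}\int_{\mathbb{C}}|f(z)|^p e^{-\frac{\alpha p}{2}|z|^2}\,dm(z)\right)^{1/p}$, where $dm$ is area measure on $\mathbb{C}$. The space $\mathcal{F}^\infty_\alpha$ consists of the entire functions with finite norm $\|f\|=\sup_{z\in\mathbb{C}}|f(z)|e^{-\frac{\alpha}{2}|z|^2}$. The space $\mathcal{F}^\infty_{\alpha,0}$ is the closed subspace of $\mathcal{F}^\infty_\alpha$ of entire functions with $\lim_{z\to\infty}f(z)e^{-\frac{\alpha}{2}|z|^2}=0$. The operator $W_{\psi,\varphi}$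 is said to be bounded (compact) on one of these spaces $X$ if it maps $X$ into $X$ and is a bounded (compact) linear operator there. For an entire function $f$ let $M_f(r)=\max_{|z|=r}|f(z)|$. The order of $f$ is $\rho=\limsup_{r\to\infty}\frac{\log\log M_f(r)}{\log r}$ (polynomials, including constants, have order $0$). If $f$ has finite order $\rho$, its type is $\sigma=\limsup_{r\to\infty}\frac{\log M_f(r)}{r^\rho}$. *)

(* Defs.v *)
From mathcomp Require Import all_boot all_order all_algebra.
From mathcomp Require Export complex.
From mathcomp Require Import all_classical all_reals all_analysis.

Set Implicit Arguments.
Unset Strict Implicit.
Unset Printing Implicit Defensive.

Import Order.TTheory GRing.Theory Num.Theory.
Import numFieldNormedType.Exports.

Local Open Scope classical_set_scope.
Local Open Scope complex_scope.
Local Open Scope ring_scope.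

Section FockSpaces.
Context {R : realType}.
Implicit Types (f : R[i] -> R[i]) (alpha r : R) (p : \bar R).

(* The modulus as an element of R: the norm `|z| of the numFieldType R[i] has
   values in R[i]. *)
Definition modulus (z : R[i]) : R := ComplexField.Normc.normc z.

(* R[i]^o is R[i] with its canonical normed module structure over itself, so
   that the difference quotients range over complex increments. *)
Definition entire f : Prop :=
  forall z : R[i], derivable (f : R[i]^o -> R[i]^o) z 1.

Definition gauss_weight (c : R) (z : R[i]) : R := expR (- c * modulus z ^+ 2).

(* Area measure on the complex plane is Lebesgue measure in the coordinates
   (x, y) of z = x + iy.  The value at p = -oo is irrelevant. *)
Definition fock_norm alpha p f : \bar R :=
  match p with
  | q%:E =>
      ((alpha * q / (2 * pi))%:E *
       \int[(@lebesgue_measure R) \x (@lebesgue_measure R)]_w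
          (modulus (f (w.1 +i* w.2)) `^ q *
           gauss_weight (alpha * q / 2) (w.1 +i* w.2))%:E) `^ q^-1
  | +oo => ereal_sup
      [set (modulus (f z) * gauss_weight (alpha / 2) z)%:E | z in setT]
  | -oo => 0
  end%E.

Definition fock alpha p : set (R[i] -> R[i]) :=
  [set f | entire f /\ (fock_norm alpha p f < +oo)%E].

Definition fock0 alpha : set (R[i] -> R[i]) :=
  [set f | fock alpha +oo%E f /\
    forall e : R, 0 < e -> exists r : R, forall z : R[i], r <= modulus z ->
      modulus (f z) * gauss_weight (alpha / 2) z < e].

Definition linear_operator (X : set (R[i] -> R[i]))
    (T : (R[i] -> R[i]) -> R[i] -> R[i]) : Prop :=
  (forall f, X f -> X (T f)) /\
  (forall (c : R[i]) f g, X f -> X g ->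
     T (fun z => c * f z + g z) = (fun z => c * T f z + T g z)).

Definition bounded_operator (X : set (R[i] -> R[i]))
    (nrm : (R[i] -> R[i]) -> \bar R)
    (T : (R[i] -> R[i]) -> R[i] -> R[i]) : Prop :=
  linear_operator X T /\
  exists M : R, forall f, X f -> (nrm (T f) <= M%:E * nrm f)%E.

(* Every bounded sequence of X has a subsequence whose image under T converges
   in X. *)
Definition compact_operator (X : set (R[i] -> R[i]))
    (nrm : (R[i] -> R[i]) -> \bar R)
    (T : (R[i] -> R[i]) -> R[i] -> R[i]) : Prop :=
  linear_operator X T /\
  forall (u : nat -> R[i] -> R[i]) (M : R),
    (forall n, X (u n) /\ (nrm (u n) <= M%:E)%E) ->
    exists (s : nat -> nat) (g : R[i] -> R[i]),
      [/\ increasing_seq s, X g &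
          nrm (fun z => T (u (s n)) z - g z) @[n --> \oo] --> 0%E].

Definition weighted_comp (psi phi f : R[i] -> R[i]) : R[i] -> R[i] :=
  fun z => psi z * f (phi z).

(* The supremum is attained when f is continuous and 0 <= r. *)
Definition max_modulus f r : R :=
  sup [set modulus (f z) | z in [set z | modulus z = r]].

(* Since ln x = 0 for x <= 0, the order of a constant is 0 with no special
   case, also when log (log M_f) is undefined; for a nonconstant entire f,
   M_f tends to infinity and both logarithms are eventually genuine. *)
Definition entire_order f : \bar R :=
  limf_esup (fun r : R => (ln (ln (max_modulus f r)) / ln r)%:E) (pinfty_nbhs R).

(* Meaningful only when the order is finite. *)
Definition entire_type f : \bar R :=
  limf_esup (fun r : R =>
    (ln (max_modulus f r) / r `^ fine (entire_order f))%:E) (pinfty_nbhs R).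

End FockSpaces.

(* Main.v *)
(* Point evaluations are controlled by the Fock norm, |f(z)| e^(-alpha |z|^2 / 2) <= B
   on bounded sets, by the Cauchy formula on squares around z. Hence
     |W f(z)| e^(-alpha |z|^2 / 2) <=
       B |psi(z)| e^(alpha |phi(z)|^2 / 2 - alpha |z|^2 / 2),
   and the last exponent is - alpha beta |z|^2 / 2 + O(|z|).

   (i) If |psi(z)| <= C e^(t |z|^2) with t < alpha beta / 2, then W f has Gaussian
   decay uniformly on bounded sets, so that locally uniform convergence along a normal
   family (Montel) upgrades to convergence of W in norm, for all p at once.

   (ii) The kernels k_w(z) = e^(alpha conj(w) z - alpha |w|^2 / 2) have norms bounded
   independently of w. If W is bounded, then evaluating W k_w at z with w = phi(z)
   bounds |psi(z)| by a multiple of e^(alpha beta |z|^2 / 2 + O(|z|)).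

   For the Cauchy estimates the real functional Im (integral of F(z) dz) suffices:
   normalizing F to equal 1 at the pole b, one only needs
   Im (integral of dz / (z - b)) >= 1. *)
Require Import Defs.
From mathcomp Require Import all_boot all_order all_algebra.
From mathcomp Require Import complex ring lra.
From mathcomp Require Import all_classical all_reals all_analysis.
From mathcomp Require Import measurable_realfun.
Set Implicit Arguments.
Unset Strict Implicit.
Unset Printing Implicit Defensive.
Import Order.TTheory GRing.Theory Num.Theory.
Import numFieldNormedType.Exports.
Local Open Scope classical_set_scope.
Local Open Scope complex_scope.
Local Open Scope ring_scope.
Local Notation Re := mathcomp.real_closed.complex.Re.
Local Notation Im := mathcomp.real_closed.complex.Im.

(** * Complex differentiability *)

Section Modulus.
Context {R : realType}.
Implicit Types (z w : R[i]) (x y : R).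

(** Entire functions are given as pointwise differentiable ones, with no continuity of the
    derivative, and this forces Goursat's bisection. The rest of Cauchy's theory is drawn from one
    mechanism. A quotient whose numerator vanishes at the pole integrates to zero: Goursat's theorem
    with an exceptional point replaces the removal of singularities. Adding such null terms changes
    the kernel but not the integral, which stays at least 1, while the new kernel is small. This
    yields a Lipschitz constant and a second-order Taylor remainder; being uniform over a locally
    bounded family, they make its limits entire.

    For finite p only an area integral is available, not a maximum over a contour. The four sides
    are therefore chosen by averaging over unit strips, which is why the basic estimates allow
    rectangles that are not centred at the pole.

    The gap between t and alpha beta / 2 is spent in portions: one absorbs the O(|z|) term, one
    makes the values far out small, and one remains as a Gaussian, whose norm is finite for every
    p. *)

Lemma modulus0 : modulus (0 : R[i]) = 0.
Proof. exact: ComplexField.Normc.normc0. Qed.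

Lemma modulusM z w : modulus (z * w) = modulus z * modulus w.
Proof. exact: ComplexField.Normc.normcM. Qed.

Lemma modulusV z : modulus z^-1 = (modulus z)^-1.
Proof. exact: ComplexField.Normc.normcV. Qed.

Lemma modulusN z : modulus (- z) = modulus z.
Proof. exact: normcN. Qed.

Lemma modulusB z w : modulus (z - w) = modulus (w - z).
Proof. by rewrite -modulusN opprB. Qed.

Lemma le_modulusD z w : modulus (z + w) <= modulus z + modulus w.
Proof. exact: le_normcD. Qed.

Lemma le_modulusB z w : modulus (z - w) <= modulus z + modulus w.
Proof. by rewrite (le_trans (le_modulusD _ _))// modulusN. Qed.

Lemma modulus_ge0 z : 0 <= modulus z.
Proof. by case: z => x y; exact: sqrtr_ge0. Qed.

Lemma modulus_eq0 z : (modulus z == 0) = (z == 0).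
Proof.
apply/eqP/eqP => [/ComplexField.Normc.eq0_normc//|->]; exact: modulus0.
Qed.

Lemma modulus_gt0 z : (0 < modulus z) = (z != 0).
Proof. by rewrite lt_neqAle modulus_ge0 andbT eq_sym modulus_eq0. Qed.

Lemma sqr_modulus z : modulus z ^+ 2 = Re z ^+ 2 + Im z ^+ 2.
Proof. by case: z => x y; rewrite /= sqr_sqrtr// addr_ge0 ?sqr_ge0. Qed.

Lemma modulus_real x : modulus x%:C = `|x|.
Proof. by rewrite /modulus /= expr0n addr0 sqrtr_sqr. Qed.

Lemma modulus_i : modulus ('i : R[i]) = 1.
Proof. by rewrite /modulus /= expr0n expr1n add0r sqrtr1. Qed.

Lemma le_Re_modulus z : `|Re z| <= modulus z.
Proof.
rewrite -(ler_pXn2r (n := 2))// ?nnegrE ?modulus_ge0//.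
by rewrite real_normK ?num_real// sqr_modulus lerDl sqr_ge0.
Qed.

Lemma le_Im_modulus z : `|Im z| <= modulus z.
Proof.
rewrite -(ler_pXn2r (n := 2))// ?nnegrE ?modulus_ge0//.
by rewrite real_normK ?num_real// sqr_modulus lerDr sqr_ge0.
Qed.

Lemma modulus_le_ReIm z : modulus z <= `|Re z| + `|Im z|.
Proof.
rewrite [z in modulus z]complexE.
rewrite (le_trans (le_modulusD _ _))// modulusM modulus_i mul1r.
by rewrite !modulus_real.
Qed.

Lemma ler_modulus_sub z w : modulus z - modulus w <= modulus (z - w).
Proof. by rewrite lerBlDr (le_trans _ (le_modulusD _ _))// subrK. Qed.

Lemma modulusE x y : modulus (x +i* y) = Num.sqrt (x ^+ 2 + y ^+ 2).
Proof. by []. Qed.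

End Modulus.

Section ComplexDerivative.
Context {R : realType}.
Implicit Types (f g : R[i] -> R[i]) (z d : R[i]).

(** The limit of difference quotients, cleared of the division and stated in the ordered field [R]
    rather than in [R[i]], so that linear arithmetic applies. At [h = 0] both sides vanish. *)
Definition cdiff f z d := forall e : R, 0 < e ->
  exists2 r : R, 0 < r & forall h, modulus h < r ->
    modulus (f (z + h) - f z - d * h) <= e * modulus h.

Lemma derivable_cdiff f z :
  derivable (f : R[i]^o -> R[i]^o) z 1 <-> exists d, cdiff f z d.
Proof.
split.
  move=> /cvg_ex[d /cvgrPdist_le D]; exists d => e e0.
  have := D e%:C; rewrite ltcR => /(_ e0).
  case/nbhs_ballP => r /=.
  rewrite ltcE /= => /andP[/eqP r1 r2] H.
  exists (Re r) => // h hr.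
  have [->|h0] := eqVneq h 0; first by rewrite addr0 mulr0 !subrr modulus0 mulr0.
  have := H h.
  rewrite -ball_normE /= sub0r normrN.
  have -> : (`|h| < r) by rewrite ltcE /= r1 eqxx.
  move=> /(_ isT h0) /=.
  rewrite [X in X <= _](_ : _ = (modulus (d - h^-1 * (f (h%:A + z) - f z)))%:C)//.
  rewrite lecR => /(ler_wpM2r (modulus_ge0 h)).
  rewrite -modulusM mulrBl mulrAC mulVf// mul1r /GRing.scale/= mulr1 modulusB.
  by rewrite [h + z]addrC; apply.
move=> [d D]; apply/cvg_ex; exists d; apply/cvgrPdist_le => e.
rewrite ltcE /= => /andP[/eqP e1 e0].
have [r r0 H] := D _ e0.
apply/nbhs_ballP; exists r%:C; first by rewrite /= ltcR.
move=> h; rewrite -ball_normE /= sub0r normrN ltcR => hr h0.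
rewrite [X in X <= _](_ : _ = (modulus (d - h^-1 * (f (h%:A + z) - f z)))%:C)//.
rewrite lecE /= e1 eqxx /=.
rewrite -(ler_pM2r (x := modulus h)) ?modulus_gt0//.
rewrite -modulusM mulrBl mulrAC mulVf// mul1r /GRing.scale/= mulr1 modulusB.
by rewrite [h + z]addrC H.
Qed.

Lemma entireP f : entire f <-> forall z, exists d, cdiff f z d.
Proof. by split => H z; apply/derivable_cdiff. Qed.

Definition ccont f z := forall e : R, 0 < e ->
  exists2 r : R, 0 < r & forall h, modulus h < r ->
    modulus (f (z + h) - f z) <= e.

Lemma cdiff_ccont f z d : cdiff f z d -> ccont f z.
Proof.
move=> /(_ 1 ltr01)[r r0 H] e e0.
have M0 : 0 < 1 + modulus d by rewrite ltr_pwDl ?modulus_ge0.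
exists (Num.min r (e / (1 + modulus d))); first by rewrite lt_min r0 divr_gt0.
move=> h; rewrite lt_min => /andP[/H h1 h2].
rewrite -[X in modulus X](subrK (d * h)) (le_trans (le_modulusD _ _))//.
rewrite modulusM (le_trans (lerD h1 (lexx _)))// -mulrDl mulrC -ler_pdivlMr//.
exact: ltW.
Qed.

Lemma ccontP f z : ccont f z <->
  {for z, continuous (f : R[i]^o -> R[i]^o)}.
Proof.
split.
  move=> H; apply/(@cvgrPdist_le _ R[i]^o _ _ (nbhs_filter (z : R[i]^o))) => e.
  rewrite ltcE /= => /andP[/eqP e1 e0].
  have [r r0 {}H] := H _ e0.
  apply/nbhs_ballP; exists r%:C; first by rewrite /= ltcR.
  move=> h; rewrite -ball_normE /= ltcR => hr.
  rewrite lecE /= e1 eqxx /=.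
  have := H (h - z); rewrite [z + _]addrC subrK => H'.
  rewrite [X in X <= _](_ : _ = modulus (f z - f h))//.
  by rewrite modulusB H'// modulusB.
move=> /cvgrPdist_le H e e0.
have := H e%:C; rewrite ltcR => /(_ e0).
case/nbhs_ballP => r /=.
rewrite ltcE /= => /andP[/eqP r1 r2] H'.
exists (Re r) => // h hr.
have := H' (z + h); rewrite -ball_normE /= opprD addNKr normrN.
have -> : (`|h| < r) by rewrite ltcE /= r1 eqxx.
by rewrite -normrN opprB => /(_ isT); rewrite lecR.
Qed.

Lemma entire_ccont f z : entire f -> ccont f z.
Proof. by move=> /entireP/(_ z)[d]; exact: cdiff_ccont. Qed.

Lemma entire_cst z : entire (fun=> z).
Proof. by move=> w; exact: (@derivable_cst _ _ _ (z : R[i]^o)). Qed.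

Lemma entire_id : entire (@id R[i]).
Proof. by move=> w; exact: derivable_id. Qed.

Lemma entireD f g : entire f -> entire g -> entire (fun z => f z + g z).
Proof. by move=> hf hg z; exact: (@derivableD R[i] R[i]^o R[i]^o f g). Qed.

Lemma entireM f g : entire f -> entire g -> entire (fun z => f z * g z).
Proof. by move=> hf hg z; exact: (@derivableM R[i] R[i]^o f g). Qed.

Lemma entire_comp f g : entire f -> entire g -> entire (fun z => f (g z)).
Proof.
move=> hf hg z; apply/derivable1_diffP.
apply: (@differentiable_comp _ R[i]^o R[i]^o R[i]^o g f z).
  exact/derivable1_diffP.
exact/derivable1_diffP.
Qed.

Lemma entire_affine z w : entire (fun u => z + w * u).
Proof.
apply: entireD; first exact: entire_cst.
by apply: entireM; [exact: entire_cst|exact: entire_id].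
Qed.

Lemma derivable_inv_sub a z : z != a ->
  derivable ((fun w => (w - a)^-1) : R[i]^o -> R[i]^o) z 1.
Proof.
move=> za; apply: (@derivableV R[i] R[i]^o (fun w => w - a) z 1).
  by rewrite subr_eq0.
apply: derivableB; [exact: derivable_id|exact: (@derivable_cst _ _ _ (a : R[i]^o))].
Qed.

End ComplexDerivative.

(** * Goursat's theorem on rectangles *)

Section SegmentIntegral.
Context {R : realType}.
Implicit Types (f g : R -> R) (a b c t M : R).

Definition seg_int a b f : R := (\int[@lebesgue_measure R]_(t in `[a, b]) f t)%R.

(** Continuity is two-sided even at the endpoints. This suits restrictions to a side of functions
    that are continuous in the plane at each point of that side. *)
Definition seg_cont a b f := forall t, a <= t <= b -> {for t, continuous f}.

Lemma seg_integrable a b f : seg_cont a b f ->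
  (@lebesgue_measure R).-integrable `[a, b]%classic (EFin \o f).
Proof.
move=> fc; apply: continuous_compact_integrable; first exact: segment_compact.
apply: continuous_in_subspaceT => t; rewrite inE /= in_itv /=; exact: fc.
Qed.

Lemma seg_contS a b a' b' f : a <= a' -> b' <= b -> seg_cont a b f ->
  seg_cont a' b' f.
Proof.
move=> aa bb fc t /andP[t1 t2]; apply: fc.
by rewrite (le_trans aa)//= (le_trans t2).
Qed.

Lemma seg_intD a b f g : seg_cont a b f -> seg_cont a b g ->
  seg_int a b (fun t => f t + g t) = seg_int a b f + seg_int a b g.
Proof. by move=> fc gc; apply: RintegralD => //; exact: seg_integrable. Qed.

Lemma seg_intB a b f g : seg_cont a b f -> seg_cont a b g ->
  seg_int a b (fun t => f t - g t) = seg_int a b f - seg_int a b g.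
Proof. by move=> fc gc; apply: RintegralB => //; exact: seg_integrable. Qed.

Lemma eq_seg_int a b f g : (forall t, a <= t <= b -> f t = g t) ->
  seg_int a b f = seg_int a b g.
Proof.
by move=> fg; apply: eq_Rintegral => t; rewrite inE /= in_itv /=; exact: fg.
Qed.

Lemma seg_int_cst a b c : a <= b -> seg_int a b (fun=> c) = c * (b - a).
Proof.
move=> ab; rewrite /seg_int Rintegral_cst//= lebesgue_measure_itv/= lte_fin.
case: ltP => // ba; have -> : a = b by apply/le_anti; rewrite ab ba.
by rewrite subrr mulr0.
Qed.

Lemma seg_int_split a b c f : a <= c -> c <= b -> seg_cont a b f ->
  seg_int a b f = seg_int a c f + seg_int c b f.
Proof.
move=> ac cb fc; apply/eqP; rewrite addrC -subr_eq; apply/eqP.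
rewrite /seg_int Rintegral_itvB; last 3 first.
- exact: seg_integrable.
- by rewrite bnd_simp.
- by rewrite bnd_simp.
apply: Rintegral_itv_obnd_cbnd.
apply: integrableS (seg_integrable (seg_contS ac (lexx b) fc)) => //.
by move=> t /=; rewrite !in_itv/= => /andP[/ltW -> ->].
Qed.

Lemma le_seg_int a b f g : seg_cont a b f -> seg_cont a b g ->
  (forall t, a <= t <= b -> f t <= g t) -> seg_int a b f <= seg_int a b g.
Proof.
move=> fc gc fg; apply: le_Rintegral => //; exact: seg_integrable.
Qed.

Lemma seg_cont_cst a b c : seg_cont a b (fun=> c).
Proof. by move=> t _; exact: cst_continuous. Qed.

Lemma seg_cont_norm a b f : seg_cont a b f -> seg_cont a b (fun t => `|f t|).
Proof. by move=> fc t tab; apply: cvg_norm; exact: fc. Qed.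

Lemma seg_int_norm a b f : seg_cont a b f ->
  `|seg_int a b f| <= seg_int a b (fun t => `|f t|).
Proof. by move=> fc; apply: le_normr_Rintegral => //; exact: seg_integrable. Qed.

Lemma seg_int_bound a b f M : a <= b -> seg_cont a b f ->
  (forall t, a <= t <= b -> `|f t| <= M) -> `|seg_int a b f| <= M * (b - a).
Proof.
move=> ab fc fM; rewrite (le_trans (seg_int_norm fc))// -seg_int_cst//.
by apply: le_seg_int => //; [exact: seg_cont_norm|exact: seg_cont_cst].
Qed.

Lemma continuous_forP f t :
  (forall e, 0 < e -> exists2 r, 0 < r & forall h, `|h| < r -> `|f (t + h) - f t| <= e) ->
  {for t, continuous f}.
Proof.
move=> H; apply/cvgrPdist_le => e e0; have [r r0 {}H] := H _ e0.
apply/nbhs_ballP; exists r => // u; rewrite /ball/= => tu.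
by have := H (u - t); rewrite [t + _]addrC subrK => H'; rewrite distrC H'// distrC.
Qed.

End SegmentIntegral.

(** * Integrals along boundaries of rectangles *)

Section RectangleIntegral.
Context {R : realType}.
Implicit Types (F G : R[i] -> R[i]) (x y : R) (z d b : R[i]).

(* The imaginary part of the integral of F(z) dz along the positively oriented
   boundary of the rectangle. *)
Definition rect_int F x1 x2 y1 y2 : R :=
  seg_int y1 y2 (fun y => Re (F (x2 +i* y))) -
  seg_int y1 y2 (fun y => Re (F (x1 +i* y))) -
  (seg_int x1 x2 (fun x => Im (F (x +i* y2))) -
   seg_int x1 x2 (fun x => Im (F (x +i* y1)))).

Definition rect x1 x2 y1 y2 : set R[i] :=
  [set z | x1 <= Re z <= x2 /\ y1 <= Im z <= y2].

Definition frame x1 x2 y1 y2 : set R[i] :=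
  [set z | rect x1 x2 y1 y2 z /\ [\/ Re z = x1, Re z = x2, Im z = y1 | Im z = y2]].

Lemma cont_Re_vert F x y : ccont F (x +i* y) ->
  {for y, continuous (fun t => Re (F (x +i* t)))}.
Proof.
move=> Fc; apply: continuous_forP => e e0; have [r r0 H] := Fc _ e0.
exists r => // h hr; have -> : x +i* (y + h) = (x +i* y) + h%:C * 'i.
  by apply/eqP; rewrite eq_complex /=; apply/andP; split; apply/eqP; ring.
rewrite -raddfB (le_trans (le_Re_modulus _))//; apply: H.
by rewrite modulusM modulus_real modulus_i mulr1.
Qed.

Lemma cont_Im_hor F x y : ccont F (x +i* y) ->
  {for x, continuous (fun t => Im (F (t +i* y)))}.
Proof.
move=> Fc; apply: continuous_forP => e e0; have [r r0 H] := Fc _ e0.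
exists r => // h hr; have -> : (x + h) +i* y = (x +i* y) + h%:C.
  by apply/eqP; rewrite eq_complex /=; apply/andP; split; apply/eqP; ring.
rewrite -raddfB (le_trans (le_Im_modulus _))//; apply: H.
by rewrite modulus_real.
Qed.

Lemma frame_right x1 x2 y1 y2 t : x1 <= x2 -> y1 <= t <= y2 ->
  frame x1 x2 y1 y2 (x2 +i* t).
Proof. by move=> x12 ty; split; [rewrite /rect /= x12 lexx|constructor 2]. Qed.

Lemma frame_left x1 x2 y1 y2 t : x1 <= x2 -> y1 <= t <= y2 ->
  frame x1 x2 y1 y2 (x1 +i* t).
Proof. by move=> x12 ty; split; [rewrite /rect /= x12 lexx|constructor 1]. Qed.

Lemma frame_top x1 x2 y1 y2 t : y1 <= y2 -> x1 <= t <= x2 ->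
  frame x1 x2 y1 y2 (t +i* y2).
Proof. by move=> y12 tx; split; [rewrite /rect /= y12 lexx|constructor 4]. Qed.

Lemma frame_bottom x1 x2 y1 y2 t : y1 <= y2 -> x1 <= t <= x2 ->
  frame x1 x2 y1 y2 (t +i* y1).
Proof. by move=> y12 tx; split; [rewrite /rect /= y12 lexx|constructor 3]. Qed.

Section frame_cont.
Variables (F : R[i] -> R[i]) (x1 x2 y1 y2 : R).
Hypotheses (x12 : x1 <= x2) (y12 : y1 <= y2).
Hypothesis Fc : forall z, frame x1 x2 y1 y2 z -> ccont F z.

Lemma frame_cont_right : seg_cont y1 y2 (fun y => Re (F (x2 +i* y))).
Proof. by move=> t ty; apply: cont_Re_vert; apply: Fc; exact: frame_right. Qed.

Lemma frame_cont_left : seg_cont y1 y2 (fun y => Re (F (x1 +i* y))).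
Proof. by move=> t ty; apply: cont_Re_vert; apply: Fc; exact: frame_left. Qed.

Lemma frame_cont_top : seg_cont x1 x2 (fun x => Im (F (x +i* y2))).
Proof. by move=> t ty; apply: cont_Im_hor; apply: Fc; exact: frame_top. Qed.

Lemma frame_cont_bottom : seg_cont x1 x2 (fun x => Im (F (x +i* y1))).
Proof. by move=> t ty; apply: cont_Im_hor; apply: Fc; exact: frame_bottom. Qed.

Lemma rect_int_bound M : (forall z, frame x1 x2 y1 y2 z -> modulus (F z) <= M) ->
  `|rect_int F x1 x2 y1 y2| <= 2 * M * ((x2 - x1) + (y2 - y1)).
Proof.
move=> FM.
have h1 : `|seg_int y1 y2 (fun y => Re (F (x2 +i* y)))| <= M * (y2 - y1).
  apply: seg_int_bound => //; first exact: frame_cont_right.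
  by move=> t ty; rewrite (le_trans (le_Re_modulus _))//; exact/FM/frame_right.
have h2 : `|seg_int y1 y2 (fun y => Re (F (x1 +i* y)))| <= M * (y2 - y1).
  apply: seg_int_bound => //; first exact: frame_cont_left.
  by move=> t ty; rewrite (le_trans (le_Re_modulus _))//; exact/FM/frame_left.
have h3 : `|seg_int x1 x2 (fun x => Im (F (x +i* y2)))| <= M * (x2 - x1).
  apply: seg_int_bound => //; first exact: frame_cont_top.
  by move=> t ty; rewrite (le_trans (le_Im_modulus _))//; exact/FM/frame_top.
have h4 : `|seg_int x1 x2 (fun x => Im (F (x +i* y1)))| <= M * (x2 - x1).
  apply: seg_int_bound => //; first exact: frame_cont_bottom.
  by move=> t ty; rewrite (le_trans (le_Im_modulus _))//; exact/FM/frame_bottom.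
rewrite /rect_int; move: h1 h2 h3 h4; rewrite !ler_norml.
by move=> /andP[? ?] /andP[? ?] /andP[? ?] /andP[? ?]; apply/andP; split; lra.
Qed.

End frame_cont.

Lemma rect_intD F G x1 x2 y1 y2 : x1 <= x2 -> y1 <= y2 ->
  (forall z, frame x1 x2 y1 y2 z -> ccont F z) ->
  (forall z, frame x1 x2 y1 y2 z -> ccont G z) ->
  rect_int (fun z => F z + G z) x1 x2 y1 y2 =
  rect_int F x1 x2 y1 y2 + rect_int G x1 x2 y1 y2.
Proof.
move=> x12 y12 Fc Gc; rewrite /rect_int.
under [X in X - _ - _]eq_seg_int do rewrite raddfD.
under [X in _ - X - _]eq_seg_int do rewrite raddfD.
under [X in _ - (X - _)]eq_seg_int do rewrite raddfD.
under [X in _ - (_ - X)]eq_seg_int do rewrite raddfD.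
rewrite /= seg_intD; [|exact: frame_cont_right Fc|exact: frame_cont_right Gc].
rewrite /= seg_intD; [|exact: frame_cont_left Fc|exact: frame_cont_left Gc].
rewrite /= seg_intD; [|exact: frame_cont_top Fc|exact: frame_cont_top Gc].
rewrite /= seg_intD; [|exact: frame_cont_bottom Fc|exact: frame_cont_bottom Gc].
ring.
Qed.

Lemma eq_rect_int F G x1 x2 y1 y2 : x1 <= x2 -> y1 <= y2 ->
  (forall z, frame x1 x2 y1 y2 z -> F z = G z) ->
  rect_int F x1 x2 y1 y2 = rect_int G x1 x2 y1 y2.
Proof.
move=> x12 y12 FG; rewrite /rect_int; congr (_ - _ - (_ - _)).
- by apply: eq_seg_int => t ty; rewrite FG//; exact: frame_right.
- by apply: eq_seg_int => t ty; rewrite FG//; exact: frame_left.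
- by apply: eq_seg_int => t ty; rewrite FG//; exact: frame_top.
- by apply: eq_seg_int => t ty; rewrite FG//; exact: frame_bottom.
Qed.

Lemma rect_int_split_hor F x1 x2 y1 y2 x : x1 <= x <= x2 -> y1 <= y2 ->
  (forall z, frame x1 x2 y1 y2 z -> ccont F z) ->
  rect_int F x1 x2 y1 y2 = rect_int F x1 x y1 y2 + rect_int F x x2 y1 y2.
Proof.
move=> /andP[x1x xx2] y12 Fc; rewrite /rect_int.
rewrite (seg_int_split x1x xx2 (frame_cont_top y12 Fc)).
rewrite (seg_int_split x1x xx2 (frame_cont_bottom y12 Fc)).
ring.
Qed.

Lemma rect_int_split_vert F x1 x2 y1 y2 y : x1 <= x2 -> y1 <= y <= y2 ->
  (forall z, frame x1 x2 y1 y2 z -> ccont F z) ->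
  rect_int F x1 x2 y1 y2 = rect_int F x1 x2 y1 y + rect_int F x1 x2 y y2.
Proof.
move=> x12 /andP[y1y yy2] Fc; rewrite /rect_int.
rewrite (seg_int_split y1y yy2 (frame_cont_right x12 Fc)).
rewrite (seg_int_split y1y yy2 (frame_cont_left x12 Fc)).
ring.
Qed.

(** On opposite sides the integrands differ by a constant, and both pairs of sides contribute [Re d]
    times the area, with opposite signs. *)
Lemma rect_int_affine z d x1 x2 y1 y2 : x1 <= x2 -> y1 <= y2 ->
  rect_int (fun w => z + d * w) x1 x2 y1 y2 = 0.
Proof.
move=> x12 y12.
have Fc w : ccont (fun w => z + d * w) w by apply: entire_ccont; exact: entire_affine.
have Ff x1' x2' y1' y2' w : frame x1' x2' y1' y2' w -> ccont (fun w => z + d * w) w by [].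
rewrite /rect_int -seg_intB;
  [|exact: (frame_cont_right x12 (@Ff x1 x2 y1 y2))
   |exact: (frame_cont_left x12 (@Ff x1 x2 y1 y2))].
rewrite -seg_intB;
  [|exact: (frame_cont_top y12 (@Ff x1 x2 y1 y2))
   |exact: (frame_cont_bottom y12 (@Ff x1 x2 y1 y2))].
rewrite (@eq_seg_int _ y1 y2 _ (fun=> Re d * (x2 - x1))); last first.
  by move=> t _; case: z d {Fc Ff} => [? ?] [? ?] /=; ring.
rewrite (@eq_seg_int _ x1 x2 _ (fun=> Re d * (y2 - y1))); last first.
  by move=> t _; case: z d {Fc Ff} => [? ?] [? ?] /=; ring.
by rewrite !seg_int_cst//; ring.
Qed.

End RectangleIntegral.

(** * Bisection, and the variant with an exceptional point *)

Section Goursat.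
Context {R : realType}.
Implicit Types (F : R[i] -> R[i]) (x y : R) (z d b : R[i]).

Lemma small_half_pow (c e : R) : 0 < e -> exists n, c / 2 ^+ n < e.
Proof.
move=> e0; set m := Num.bound (`|c| / e); exists m.
rewrite ltr_pdivrMr ?exprn_gt0// (le_lt_trans (ler_norm _))//.
rewrite mulrC -ltr_pdivrMr//.
have: `|c| / e < m%:R by apply: archi_boundP; rewrite divr_ge0// ltW.
move/lt_le_trans; apply.
by rewrite -natrX ler_nat ltnW// ltn_expl.
Qed.

Section bisection.
Variables (F : R[i] -> R[i]) (x1 x2 y1 y2 : R).
Hypotheses (x12 : x1 <= x2) (y12 : y1 <= y2).
Hypothesis Fd : forall z, rect x1 x2 y1 y2 z -> exists d, cdiff F z d.

Let w := x2 - x1.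
Let h := y2 - y1.
Let wn n := w / 2 ^+ n.
Let hn n := h / 2 ^+ n.
Let J0 : R := `|rect_int F x1 x2 y1 y2|.
(** A rectangle of the bisection is encoded by its lower left corner, since its level [n] determines
    its size. *)
Let sub n (p : R * R) := rect_int F p.1 (p.1 + wn n) p.2 (p.2 + hn n).
Let good n (p : R * R) :=
  [/\ x1 <= p.1, p.1 + wn n <= x2, y1 <= p.2, p.2 + hn n <= y2 &
      J0 / 4 ^+ n <= `|sub n p|].

Let wn0 n : 0 <= wn n. Proof. by rewrite divr_ge0 ?exprn_ge0// subr_ge0. Qed.
Let hn0 n : 0 <= hn n. Proof. by rewrite divr_ge0 ?exprn_ge0// subr_ge0. Qed.
Let wnS n : wn n = wn n.+1 + wn n.+1.
Proof. by rewrite /wn exprSr; field; rewrite expf_neq0. Qed.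
Let hnS n : hn n = hn n.+1 + hn n.+1.
Proof. by rewrite /hn exprSr; field; rewrite expf_neq0. Qed.

Let Fc z : rect x1 x2 y1 y2 z -> ccont F z.
Proof. by move=> /Fd[d]; exact: cdiff_ccont. Qed.

Let next n (p p' : R * R) := [/\ p.1 <= p'.1, p'.1 + wn n.+1 <= p.1 + wn n,
   p.2 <= p'.2, p'.2 + hn n.+1 <= p.2 + hn n & good n.+1 p'].

(** The integrals over the four quarters add up to the whole, so by the triangle inequality one
    quarter keeps at least a fourth of the modulus. *)
Let step n (p : R * R) : good n p -> exists p', next n p p'.
Proof.
move=> [px1 px2 py1 py2 pJ].
have Wn := wnS n; have Hn := hnS n.
have W0 := wn0 n.+1; have H0 := hn0 n.+1.
pose xm := p.1 + wn n.+1; pose ym := p.2 + hn n.+1.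
have Fr (a1 a2 b1 b2 : R) : p.1 <= a1 -> a2 <= p.1 + wn n -> p.2 <= b1 ->
    b2 <= p.2 + hn n -> forall z, frame a1 a2 b1 b2 z -> ccont F z.
  move=> ? ? ? ? z [[/andP[? ?] /andP[? ?]] _]; apply: Fc; split; apply/andP; split; lra.
have split4 : sub n p = (sub n.+1 p + sub n.+1 (p.1, ym)) +
    (sub n.+1 (xm, p.2) + sub n.+1 (xm, ym)).
  rewrite /sub /=.
  rewrite (@rect_int_split_hor _ F _ _ _ _ xm); first last.
  - by apply: Fr => //; lra.
  - by lra.
  - by rewrite /xm; apply/andP; split; lra.
  rewrite (@rect_int_split_vert _ F p.1 xm _ _ ym); first last.
  - by apply: Fr => //; rewrite /xm; lra.
  - by rewrite /ym; apply/andP; split; lra.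
  - by rewrite /xm; lra.
  rewrite (@rect_int_split_vert _ F xm _ _ _ ym); first last.
  - by apply: Fr => //; rewrite /xm; lra.
  - by rewrite /ym; apply/andP; split; lra.
  - by rewrite /xm; lra.
  by rewrite Wn Hn /xm /ym !addrA.
have J4 : J0 / 4 ^+ n = 4 * (J0 / 4 ^+ n.+1).
  by rewrite exprSr; field; rewrite expf_neq0.
have bnd : 4 * (J0 / 4 ^+ n.+1) <= (`|sub n.+1 p| + `|sub n.+1 (p.1, ym)|) +
    (`|sub n.+1 (xm, p.2)| + `|sub n.+1 (xm, ym)|).
  rewrite -J4 (le_trans pJ)// split4 (le_trans (ler_normD _ _))//.
  by apply: lerD; exact: ler_normD.
clear Fr split4 J4 pJ.
have [a|a] := leP (J0 / 4 ^+ n.+1) `|sub n.+1 p|.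
  by exists p; split; [lra|lra|lra|lra|split => //; lra].
have [b|b] := leP (J0 / 4 ^+ n.+1) `|sub n.+1 (p.1, ym)|.
  by exists (p.1, ym); rewrite /next /good /=; split; [| | | |split => //]; rewrite /ym /=; lra.
have [c|c] := leP (J0 / 4 ^+ n.+1) `|sub n.+1 (xm, p.2)|.
  by exists (xm, p.2); rewrite /next /good /=; split; [| | | |split => //]; rewrite /xm /=; lra.
have dd : J0 / 4 ^+ n.+1 <= `|sub n.+1 (xm, ym)| by lra.
by exists (xm, ym); rewrite /next /good /=; split; [| | | |split => //]; rewrite /xm /ym /=; lra.
Qed.

(** The nested rectangles shrink to a point. Subtracting the first-order expansion of [F] there does
    not change the integrals, and what remains is o(diameter) on a boundary whose length is of the
    order of the diameter. The integral at level n is thus o(4^-n), against the lower bound J0 /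
    4^n. *)
Lemma goursat : rect_int F x1 x2 y1 y2 = 0.
Proof.
apply: contrapT => /eqP; rewrite -normr_gt0 -/J0 => J0gt0.
(* The choice function must be total, so [good] moves into the conclusion as a premise; at other
   pairs any value will do. *)
have /choice[f fP] : forall np : nat * (R * R), exists p',
    good np.1 np.2 -> next np.1 np.2 p'.
  move=> [n p]; have [g|ng] := pselect (good n p); last by exists p.
  by have [p'] := step g; exists p'.
pose s := fix s n := if n is m.+1 then f (m, s m) else (x1, y1).
have good_s n : good n (s n).
  elim: n => [|n IH]; last by have [] := fP (n, s n) IH.
  split; rewrite /= /sub /wn /hn ?expr0 ?divr1 /w /h ?[_ + (_ - _)]addrC ?subrK//.
have next_s n : next n (s n) (s n.+1) by exact: (fP (n, s n) (good_s n)).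
have mono n k : (s n).1 <= (s (n + k)%N).1 /\ (s (n + k)%N).1 + wn (n + k) <= (s n).1 + wn n /\
    (s n).2 <= (s (n + k)%N).2 /\ (s (n + k)%N).2 + hn (n + k) <= (s n).2 + hn n.
  elim: k => [|k [IH1 [IH2 [IH3 IH4]]]]; first by rewrite addn0.
  rewrite addnS; have [n1 n2 n3 n4 _] := next_s (n + k)%N.
  split; first exact: le_trans n1.
  split; first exact: le_trans n2 _.
  split; first exact: le_trans n3.
  exact: le_trans n4 _.
have nest m n : (s m).1 <= (s n).1 + wn n /\ (s m).2 <= (s n).2 + hn n.
  have [mn|/ltnW nm] := leqP m n.
    have [a1 [a2 [a3 a4]]] := mono m (n - m)%N; rewrite subnKC// in a1 a2 a3 a4.
    by have := wn0 n; have := hn0 n; split; lra.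
  have [a1 [a2 [a3 a4]]] := mono n (m - n)%N; rewrite subnKC// in a1 a2 a3 a4.
  by have := wn0 m; have := hn0 m; split; lra.
(* The common point is the supremum of the lower left corners: by [nest], each of them lies below
   every upper right corner. *)
pose X := sup (range (fun n => (s n).1)); pose Y := sup (range (fun n => (s n).2)).
have Xl n : (s n).1 <= X.
  apply: ub_le_sup; last by exists n.
  by exists ((s 0%N).1 + wn 0) => _ [m _ <-]; have [] := nest m 0%N.
have Yl n : (s n).2 <= Y.
  apply: ub_le_sup; last by exists n.
  by exists ((s 0%N).2 + hn 0) => _ [m _ <-]; have [] := nest m 0%N.
have Xu n : X <= (s n).1 + wn n.
  apply: ge_sup; first by exists (s 0%N).1, 0%N.
  by move=> _ [m _ <-]; have [] := nest m n.
have Yu n : Y <= (s n).2 + hn n.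
  apply: ge_sup; first by exists (s 0%N).2, 0%N.
  by move=> _ [m _ <-]; have [] := nest m n.
have Zrect : rect x1 x2 y1 y2 (X +i* Y).
  have [g1 g2 g3 g4 _] := good_s 0%N.
  have ? := Xl 0%N; have ? := Yl 0%N; have ? := Xu 0%N; have ? := Yu 0%N.
  by split; apply/andP; split => /=; lra.
have [d Fdd] := Fd Zrect.
pose S := w + h.
have S0 : 0 <= S by rewrite addr_ge0// subr_ge0.
(* The final estimate reads J0 <= 2 e S^2, which this choice makes absurd; the 1 keeps the
   denominator positive when S = 0. *)
pose e := J0 / (4 * (S ^+ 2 + 1)).
have e0 : 0 < e by rewrite divr_gt0// mulr_gt0// ltr_wpDl// sqr_ge0.
have [r r0 H] := Fdd e e0.
have [n nr] := small_half_pow S r0.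
have [g1 g2 g3 g4 g5] := good_s n.
have near z : rect (s n).1 ((s n).1 + wn n) (s n).2 ((s n).2 + hn n) z ->
    modulus (z - (X +i* Y)) <= S / 2 ^+ n.
  move=> [/andP[? ?] /andP[? ?]]; rewrite (le_trans (modulus_le_ReIm _))//.
  rewrite /S mulrDl -/(wn n) -/(hn n).
  have ? := Xl n; have ? := Yl n; have ? := Xu n; have ? := Yu n.
  by apply: lerD; rewrite raddfB ler_norml /=; apply/andP; split; lra.
pose A z := (F (X +i* Y) - d * (X +i* Y)) + d * z.
pose E z := F z - A z.
have Ac z : ccont A z by apply: entire_ccont; exact: entire_affine.
have Fc' z : frame (s n).1 ((s n).1 + wn n) (s n).2 ((s n).2 + hn n) z -> ccont F z.
  by move=> [[/andP[? ?] /andP[? ?]] _]; apply: Fc; split; apply/andP; split; lra.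
have wl : (s n).1 <= (s n).1 + wn n by rewrite lerDl.
have hl : (s n).2 <= (s n).2 + hn n by rewrite lerDl.
have Ec z : frame (s n).1 ((s n).1 + wn n) (s n).2 ((s n).2 + hn n) z -> ccont E z.
  move=> /Fc' /ccontP Fz; apply/ccontP.
  have Az : {for z, continuous (A : R[i]^o -> R[i]^o)} by apply/ccontP.
  exact: (@continuousB _ R[i]^o R[i]^o F A z Fz Az).
have JE : sub n (s n) = rect_int E (s n).1 ((s n).1 + wn n) (s n).2 ((s n).2 + hn n).
  rewrite -[RHS]addr0 -(@rect_int_affine _ (F (X +i* Y) - d * (X +i* Y)) d
    (s n).1 ((s n).1 + wn n) (s n).2 ((s n).2 + hn n))// -rect_intD//.
  by apply: eq_rect_int => // z _; rewrite /E subrK.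
have Eb z : frame (s n).1 ((s n).1 + wn n) (s n).2 ((s n).2 + hn n) z ->
    modulus (E z) <= e * (S / 2 ^+ n).
  move=> [/near Hz _].
  have := H (z - (X +i* Y)); rewrite [_ + (z - _)]addrC subrK => /(_ (le_lt_trans Hz nr)).
  rewrite (_ : F z - _ - _ = E z); last by rewrite /E /A; ring.
  by move=> /le_trans; apply; rewrite ler_wpM2l// ltW.
have := rect_int_bound wl hl Ec Eb.
rewrite -JE ![_ + _ - _]addrAC !subrr !add0r -mulrDl -/S => JB.
have {g5 JB} := le_trans g5 JB.
have -> : (4 : R) ^+ n = 2 ^+ n * 2 ^+ n by rewrite -exprMn; congr (_ ^+ n); ring.
have p2 : 0 < (2 : R) ^+ n by rewrite exprn_gt0.
rewrite ler_pdivrMr ?mulr_gt0//.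
rewrite (_ : 2 * (e * (S / 2 ^+ n)) * (S / 2 ^+ n) * (2 ^+ n * 2 ^+ n) = 2 * e * S ^+ 2);
  last by field; rewrite gt_eqF.
rewrite /e => JJ.
have S1 : 0 < S ^+ 2 + 1 by rewrite ltr_wpDl// sqr_ge0.
have : J0 < J0.
  apply: (le_lt_trans JJ).
  rewrite (_ : _ * _ = J0 * (S ^+ 2 / (2 * (S ^+ 2 + 1)))); last by field; rewrite gt_eqF.
  by rewrite gtr_pMr// ltr_pdivrMr ?mulr_gt0//; have := sqr_ge0 S; lra.
by rewrite ltxx.
Qed.

End bisection.

(* Cutting off four strips shrinks the rectangle to a square around the
   exceptional point, on whose boundary the integrand is o(1 / side). *)
Lemma goursat_exceptional F b x1 x2 y1 y2 :
  x1 < Re b < x2 -> y1 < Im b < y2 ->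
  (forall z, z != b -> exists d, cdiff F z d) ->
  (forall e : R, 0 < e -> exists2 r : R, 0 < r &
     forall k, k != 0 -> modulus k < r -> modulus k * modulus (F (b + k)) <= e) ->
  rect_int F x1 x2 y1 y2 = 0.
Proof.
move=> /andP[bx1 bx2] /andP[by1 by2] Fd Fs.
have Fc z : z != b -> ccont F z by move=> /Fd[d]; exact: cdiff_ccont.
apply: contrapT => /eqP; rewrite -normr_gt0; set J0 := `|_| => J0gt0.
(* On the boundary of a square of half-side t around b the integrand is at most J0 / (16 t), and
   that boundary has length 8 t, so the integral is at most J0 / 2. The bound t <= r / 4 keeps the
   boundary within distance r of b. *)
have [r r0 {}Fs] := Fs (J0 / 16) (divr_gt0 J0gt0 (ltr0n _ 16)).
pose t := Num.min (r / 4)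
  (Num.min (Num.min (Re b - x1) (x2 - Re b)) (Num.min (Im b - y1) (y2 - Im b)) / 2).
have t0 : 0 < t by rewrite !(lt_min, divr_gt0)//= !subr_gt0 bx1 bx2 by1.
have [tr tx1 tx2 ty1 ty2] : [/\ t <= r / 4, t <= (Re b - x1) / 2,
    t <= (x2 - Re b) / 2, t <= (Im b - y1) / 2 & t <= (y2 - Im b) / 2].
  split; rewrite /t !ge_min ?lexx//; apply/orP; right; rewrite ler_pM2r// !ge_min lexx ?orbT//.
pose a1 := Re b - t; pose a2 := Re b + t; pose b1 := Im b - t; pose b2 := Im b + t.
have neq z : Re z < Re b \/ Re b < Re z \/ Im z < Im b \/ Im b < Im z -> z != b.
  by move=> H; apply/eqP => zb; rewrite zb !ltxx in H; move: H => [|[|[|]]].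
have fr (c1 c2 d1 d2 : R) : c1 < Re b < c2 -> d1 < Im b < d2 ->
    forall z, frame c1 c2 d1 d2 z -> ccont F z.
  move=> /andP[? ?] /andP[? ?] z [_ zz]; apply: Fc; apply: neq.
  by case: zz => ->; [left|right;left|right;right;left|do 3 right].
have gx (c1 c2 d1 d2 : R) : c1 <= c2 -> d1 <= d2 ->
   (forall z, rect c1 c2 d1 d2 z -> z != b) -> rect_int F c1 c2 d1 d2 = 0.
  by move=> c12 d12 H; apply: goursat => // z /H/Fd.
have e1 : rect_int F x1 x2 y1 y2 = rect_int F a1 a2 b1 b2.
  rewrite (@rect_int_split_hor _ F _ _ _ _ a1); first last.
  - by apply: fr; rewrite ?bx1 ?bx2 ?by1.
  - by lra.
  - by rewrite /a1; apply/andP; split; lra.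
  rewrite gx ?add0r; first last.
  - by rewrite /rect /= /a1 => z [/andP[? ?] _]; apply: neq; left; lra.
  - by lra.
  - by rewrite /a1; lra.
  rewrite (@rect_int_split_hor _ F _ _ _ _ a2); first last.
  - by apply: fr; rewrite ?bx2 ?by1 ?by2//= /a1; apply/andP; split; lra.
  - by lra.
  - by rewrite /a1 /a2; apply/andP; split; lra.
  rewrite [X in _ + X]gx ?addr0; first last.
  - by rewrite /rect /= /a2 => z [/andP[? ?] _]; apply: neq; right; left; lra.
  - by lra.
  - by rewrite /a2; lra.
  rewrite (@rect_int_split_vert _ F _ _ _ _ b1); first last.
  - by apply: fr; rewrite ?by1 ?by2//= /a1 /a2; apply/andP; split; lra.
  - by rewrite /b1; apply/andP; split; lra.
  - by rewrite /a1 /a2; lra.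
  rewrite gx ?add0r; first last.
  - by rewrite /rect /= /b1 => z [_ /andP[? ?]]; apply: neq; right; right; left; lra.
  - by rewrite /b1; lra.
  - by rewrite /a1 /a2; lra.
  rewrite (@rect_int_split_vert _ F _ _ _ _ b2); first last.
  - by apply: fr; rewrite /= /a1 /a2 /b1; apply/andP; split; lra.
  - by rewrite /b1 /b2; apply/andP; split; lra.
  - by rewrite /a1 /a2; lra.
  rewrite [X in _ + X]gx ?addr0//.
  - by rewrite /a1 /a2; lra.
  - by rewrite /b2; lra.
  - by rewrite /rect /= /b2 => z [_ /andP[? ?]]; apply: neq; right; right; right; lra.
have fr2 : forall z, frame a1 a2 b1 b2 z -> ccont F z.
  by apply: fr; rewrite /a1 /a2 /b1 /b2; apply/andP; split; lra.
have bd z : frame a1 a2 b1 b2 z -> modulus (F z) <= J0 / 16 / t.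
  move=> zf; have [[/andP[z1 z2] /andP[z3 z4]] z5] := zf.
  have zt : t <= modulus (z - b).
    case: z5 => z5.
    - rewrite (le_trans _ (le_Re_modulus _))// raddfB /= z5 /a1.
      by rewrite ler_normr; apply/orP; right; lra.
    - rewrite (le_trans _ (le_Re_modulus _))// raddfB /= z5 /a2.
      by rewrite ler_normr; apply/orP; left; lra.
    - rewrite (le_trans _ (le_Im_modulus _))// raddfB /= z5 /b1.
      by rewrite ler_normr; apply/orP; right; lra.
    - rewrite (le_trans _ (le_Im_modulus _))// raddfB /= z5 /b2.
      by rewrite ler_normr; apply/orP; left; lra.
  have zr : modulus (z - b) < r.
    rewrite (le_lt_trans (modulus_le_ReIm _))// (le_lt_trans (lerD (y := t) (t := t) _ _))//.
    - by rewrite raddfB ler_norml /=; rewrite /a1 /a2 in z1 z2; apply/andP; split; lra.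
    - by rewrite raddfB ler_norml /=; rewrite /b1 /b2 in z3 z4; apply/andP; split; lra.
    - by lra.
  have k0 : z - b != 0 by rewrite -modulus_gt0 (lt_le_trans t0).
  have := Fs _ k0 zr; rewrite [b + _]addrC subrK => Fz.
  rewrite ler_pdivlMr// mulrC (le_trans _ Fz)// ler_wpM2r ?modulus_ge0//.
have := rect_int_bound _ _ fr2 bd.
rewrite -e1 -/J0 => /(_ _ _) H.
have : J0 <= J0 / 2.
  apply: (le_trans (H _ _)).
  - by rewrite /a1 /a2; lra.
  - by rewrite /b1 /b2; lra.
  - have -> : 2 * (J0 / 16 / t) * (a2 - a1 + (b2 - b1)) = J0 / 2 => //.
    by rewrite /a1 /a2 /b1 /b2; field; rewrite gt_eqF.
by lra.
Qed.

End Goursat.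

(** * Cauchy estimates *)

Section CauchyEstimates.
Context {R : realType}.
Implicit Types (f F G : R[i] -> R[i]) (a b c d z : R[i]) (x y : R).

Lemma modulus_frame b x1 x2 y1 y2 z :
  1 <= Re b - x1 -> 1 <= x2 - Re b -> 1 <= Im b - y1 -> 1 <= y2 - Im b ->
  frame x1 x2 y1 y2 z -> 1 <= modulus (z - b).
Proof.
move=> bx1 bx2 by1 by2 [_]; case=> zE.
- by rewrite (le_trans _ (le_Re_modulus _))// raddfB /= zE ler_normr; apply/orP; right; lra.
- by rewrite (le_trans _ (le_Re_modulus _))// raddfB /= zE ler_normr; apply/orP; left; lra.
- by rewrite (le_trans _ (le_Im_modulus _))// raddfB /= zE ler_normr; apply/orP; right; lra.
- by rewrite (le_trans _ (le_Im_modulus _))// raddfB /= zE ler_normr; apply/orP; left; lra.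
Qed.

Lemma frame_neq b x1 x2 y1 y2 z :
  x1 < Re b < x2 -> y1 < Im b < y2 -> frame x1 x2 y1 y2 z -> z != b.
Proof.
move=> /andP[? ?] /andP[? ?] [_ zE]; apply/eqP => zb; rewrite zb in zE.
by case: zE; lra.
Qed.

Lemma derivable_div_sub F b z : entire F -> z != b ->
  derivable ((fun w => F w * (w - b)^-1) : R[i]^o -> R[i]^o) z 1.
Proof.
move=> Fe zb; apply: (@derivableM R[i] R[i]^o F) => //.
exact: derivable_inv_sub.
Qed.

Lemma ccont_div_sub F b z : entire F -> z != b -> ccont (fun w => F w * (w - b)^-1) z.
Proof.
by move=> Fe /(derivable_div_sub Fe)/derivable_cdiff[d]; exact: cdiff_ccont.
Qed.

Lemma derivable_div_sub2 F b z : entire F -> z != b ->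
  derivable ((fun w => F w * (w - b)^-1 * (w - b)^-1) : R[i]^o -> R[i]^o) z 1.
Proof.
move=> Fe zb; apply: (@derivableM R[i] R[i]^o (fun w => F w * (w - b)^-1)).
  exact: derivable_div_sub.
exact: derivable_inv_sub.
Qed.

Lemma ccont_div_sub2 F b z : entire F -> z != b ->
  ccont (fun w => F w * (w - b)^-1 * (w - b)^-1) z.
Proof.
by move=> Fe /(derivable_div_sub2 Fe)/derivable_cdiff[d]; exact: cdiff_ccont.
Qed.

(** Continuity at the zero [b] already makes the quotient o(1 / |z - b|), which is what
    [goursat_exceptional] asks for. *)
Lemma rect_int_div_sub_eq0 F b x1 x2 y1 y2 : entire F -> F b = 0 ->
  x1 < Re b < x2 -> y1 < Im b < y2 ->
  rect_int (fun z => F z * (z - b)^-1) x1 x2 y1 y2 = 0.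
Proof.
move=> Fe Fb bx by_; apply: (goursat_exceptional bx by_).
  by move=> z zb; apply/derivable_cdiff; exact: derivable_div_sub.
move=> e e0; have [r r0 H] := entire_ccont b Fe e0.
exists r => // k k0 /H; rewrite Fb subr0.
rewrite modulusM modulusV [b + k]addrC addrK mulrC -mulrA mulVf ?mulr1//.
by rewrite gt_eqF// modulus_gt0.
Qed.

(** At a zero with vanishing derivative F is o(|z - b|), so even division by (z - b)^2 leaves o(1 /
    |z - b|). *)
Lemma rect_int_div_sub2_eq0 F b x1 x2 y1 y2 : entire F -> F b = 0 -> cdiff F b 0 ->
  x1 < Re b < x2 -> y1 < Im b < y2 ->
  rect_int (fun z => F z * (z - b)^-1 * (z - b)^-1) x1 x2 y1 y2 = 0.
Proof.
move=> Fe Fb Fd bx by_; apply: (goursat_exceptional bx by_).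
  by move=> z zb; apply/derivable_cdiff; exact: derivable_div_sub2.
move=> e e0; have [r r0 H] := Fd _ e0.
exists r => // k k0 /H; rewrite Fb subr0 mul0r subr0.
rewrite !modulusM modulusV [b + k]addrC addrK => Hk.
have m0 : 0 < modulus k by rewrite modulus_gt0.
rewrite mulrC -!mulrA mulVf ?gt_eqF// mulr1.
by rewrite ler_pdivrMr.
Qed.

Lemma ReV x y : Re ((x +i* y)^-1) = x / (x ^+ 2 + y ^+ 2) :> R.
Proof. by []. Qed.

Lemma ImV x y : Im ((x +i* y)^-1) = - (y / (x ^+ 2 + y ^+ 2)) :> R.
Proof. by []. Qed.

Lemma complex_sub x y b : (x +i* y) - b = (x - Re b) +i* (y - Im b) :> R[i].
Proof. by case: b. Qed.

(** The numerator is at least 1 and the denominator at most 4 + 4. *)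
Let pole_bound (u v : R) : 1 <= u <= 2 -> v ^+ 2 <= 4 -> 1 / 8 <= u / (u ^+ 2 + v ^+ 2).
Proof. by move=> /andP[u1 u2] v2; rewrite ler_pdivlMr; nra. Qed.

(** The exact value is 2 pi, but a crude bound is enough: each side has length at least 2 and its
    integrand, with the sign of the orientation, is at least 1 / 8, so each of the four sides
    contributes at least 1 / 4. *)
Lemma rect_int_pole_ge1 b x1 x2 y1 y2 :
  1 <= Re b - x1 <= 2 -> 1 <= x2 - Re b <= 2 ->
  1 <= Im b - y1 <= 2 -> 1 <= y2 - Im b <= 2 ->
  1 <= rect_int (fun z => (z - b)^-1) x1 x2 y1 y2.
Proof.
move=> /[dup] bx1 /andP[? ?] /[dup] bx2 /andP[? ?]
  /[dup] by1 /andP[? ?] /[dup] by2 /andP[? ?].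
have x12 : x1 <= x2 by lra.
have y12 : y1 <= y2 by lra.
have fc z : frame x1 x2 y1 y2 z -> ccont (fun z => (z - b)^-1) z.
  move=> zf; have zb : z != b by apply: frame_neq zf; apply/andP; split; lra.
  have /derivable_cdiff[d] := derivable_inv_sub zb; exact: cdiff_ccont.
have low (p q : R) g : p <= q -> 2 <= q - p -> seg_cont p q g ->
    (forall t, p <= t <= q -> 1 / 8 <= g t) -> 1 / 4 <= seg_int p q g.
  move=> pq pq2 gc gl; apply: (@le_trans _ _ (seg_int p q (fun=> 1 / 8))).
    by rewrite seg_int_cst//; lra.
  by apply: le_seg_int => //; exact: seg_cont_cst.
have upp (p q : R) g : p <= q -> 2 <= q - p -> seg_cont p q g ->
    (forall t, p <= t <= q -> g t <= - (1 / 8)) -> seg_int p q g <= - (1 / 4).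
  move=> pq pq2 gc gl; apply: (@le_trans _ _ (seg_int p q (fun=> - (1 / 8)))).
    by apply: le_seg_int => //; exact: seg_cont_cst.
  by rewrite seg_int_cst//; lra.
have h1 : 1 / 4 <= seg_int y1 y2 (fun y => Re ((x2 +i* y) - b)^-1).
  apply: low => //; [lra|exact: frame_cont_right fc|].
  move=> t /andP[? ?]; rewrite complex_sub ReV; apply: pole_bound => //.
  by nra.
have h2 : seg_int y1 y2 (fun y => Re ((x1 +i* y) - b)^-1) <= - (1 / 4).
  apply: upp => //; [lra|exact: frame_cont_left fc|].
  move=> t /andP[? ?]; rewrite complex_sub ReV lerNr -mulNr opprB.
  by rewrite -[(x1 - _) ^+ 2]sqrrN opprB; apply: pole_bound => //; nra.
have h3 : seg_int x1 x2 (fun x => Im ((x +i* y2) - b)^-1) <= - (1 / 4).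
  apply: upp => //; [lra|exact: frame_cont_top fc|].
  move=> t /andP[? ?]; rewrite complex_sub ImV lerN2 [_ ^+ 2 + _]addrC.
  by apply: pole_bound => //; nra.
have h4 : 1 / 4 <= seg_int x1 x2 (fun x => Im ((x +i* y1) - b)^-1).
  apply: low => //; [lra|exact: frame_cont_bottom fc|].
  move=> t /andP[? ?]; rewrite complex_sub ImV [_ ^+ 2 + _]addrC -mulNr opprB.
  by rewrite -[(y1 - _) ^+ 2]sqrrN opprB; apply: pole_bound => //; nra.
by rewrite /rect_int; lra.
Qed.

(** Since F - 1 vanishes at b, the quotient (F - 1) / (z - b) integrates to zero and only the pole
    itself is left. *)
Lemma rect_int_cauchy_ge1 F b x1 x2 y1 y2 : entire F -> F b = 1 ->
  1 <= Re b - x1 <= 2 -> 1 <= x2 - Re b <= 2 ->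
  1 <= Im b - y1 <= 2 -> 1 <= y2 - Im b <= 2 ->
  1 <= rect_int (fun z => F z * (z - b)^-1) x1 x2 y1 y2.
Proof.
move=> Fe Fb /[dup] bx1 /andP[? ?] /[dup] bx2 /andP[? ?]
  /[dup] by1 /andP[? ?] /[dup] by2 /andP[? ?].
have bx : x1 < Re b < x2 by apply/andP; split; lra.
have by_ : y1 < Im b < y2 by apply/andP; split; lra.
rewrite (le_trans (rect_int_pole_ge1 bx1 bx2 by1 by2))//.
have Ge : entire (fun z => F z + (-1)) by exact: (entireD Fe (@entire_cst R (-1))).
have := @rect_int_div_sub_eq0 (fun z => F z + (-1)) b x1 x2 y1 y2 Ge.
rewrite Fb subrr => /(_ erefl bx by_) G0.
rewrite -[leLHS]add0r -{1}G0 -rect_intD; [|lra|lra|..].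
- rewrite (@eq_rect_int _ _ (fun z => F z * (z - b)^-1))//; [lra|lra|].
  by move=> z _; ring.
- by move=> z /(frame_neq bx by_); exact: ccont_div_sub.
- move=> z /(frame_neq bx by_) zb.
  have /derivable_cdiff[d] := derivable_inv_sub zb; exact: cdiff_ccont.
Qed.

Lemma entire_scale f c : entire f -> entire (fun z => c * f z).
Proof. by move=> fe; exact: (entireM (@entire_cst R c) fe). Qed.

Lemma seg_cont_modulus_vert f x (p q : R) : entire f ->
  seg_cont p q (fun y => modulus (f (x +i* y))).
Proof.
move=> fe t _; apply: continuous_forP => e e0.
have [r r0 H] := entire_ccont (x +i* t) fe e0.
exists r => // h hr; have E : x +i* (t + h) = (x +i* t) + h%:C * 'i.
  by apply/eqP; rewrite eq_complex /=; apply/andP; split; apply/eqP; ring.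
have := H (h%:C * 'i); rewrite modulusM modulus_real modulus_i mulr1 => /(_ hr).
rewrite E; move: (f _) (f _) => u v uv.
have := ler_modulus_sub u v; have := ler_modulus_sub v u.
by rewrite [modulus (u - v)]modulusB ler_norml => ? ?; apply/andP; split; lra.
Qed.

Lemma seg_cont_modulus_hor f y (p q : R) : entire f ->
  seg_cont p q (fun x => modulus (f (x +i* y))).
Proof.
move=> fe t _; apply: continuous_forP => e e0.
have [r r0 H] := entire_ccont (t +i* y) fe e0.
exists r => // h hr; have E : (t + h) +i* y = (t +i* y) + h%:C.
  by apply/eqP; rewrite eq_complex /=; apply/andP; split; apply/eqP; ring.
have := H (h%:C); rewrite modulus_real => /(_ hr).
rewrite E; move: (f _) (f _) => u v uv.
have := ler_modulus_sub u v; have := ler_modulus_sub v u.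
by rewrite [modulus (u - v)]modulusB ler_norml => ? ?; apply/andP; split; lra.
Qed.

(** A Cauchy estimate by integrals over the sides instead of a maximum, so that information on
    sections of an area integral suffices. After division by [f b] the integral is at least 1, while
    the kernel is at most 1 on the boundary. *)
Lemma cauchy_side_estimate f b x1 x2 y1 y2 (T : R) : entire f ->
  1 <= Re b - x1 <= 2 -> 1 <= x2 - Re b <= 2 ->
  1 <= Im b - y1 <= 2 -> 1 <= y2 - Im b <= 2 ->
  seg_int y1 y2 (fun y => modulus (f (x1 +i* y))) <= T ->
  seg_int y1 y2 (fun y => modulus (f (x2 +i* y))) <= T ->
  seg_int x1 x2 (fun x => modulus (f (x +i* y1))) <= T ->
  seg_int x1 x2 (fun x => modulus (f (x +i* y2))) <= T ->
  modulus (f b) <= 4 * T.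
Proof.
move=> fe /[dup] bx1 /andP[? ?] /[dup] bx2 /andP[? ?]
  /[dup] by1 /andP[? ?] /[dup] by2 /andP[? ?].
move=> t1 t2 t3 t4.
have x12 : x1 <= x2 by lra.
have y12 : y1 <= y2 by lra.
have T0 : 0 <= T.
  by rewrite (le_trans _ t1)//; apply: Rintegral_ge0 => t _; exact: modulus_ge0.
have [->|fb0] := eqVneq (f b) 0; first by rewrite modulus0 mulr_ge0.
have bx : x1 < Re b < x2 by apply/andP; split; lra.
have by_ : y1 < Im b < y2 by apply/andP; split; lra.
pose F z := (f b)^-1 * f z.
have Fe : entire F by exact: (@entire_scale f (f b)^-1 fe).
have Fb : F b = 1 by rewrite /F mulVf.
have Fc z : frame x1 x2 y1 y2 z -> ccont (fun w => F w * (w - b)^-1) z.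
  by move=> /(frame_neq bx by_); exact: ccont_div_sub.
have := rect_int_cauchy_ge1 Fe Fb bx1 bx2 by1 by2.
set D := modulus (f b).
have D0 : 0 < D by rewrite modulus_gt0.
have bd z : frame x1 x2 y1 y2 z -> modulus (F z * (z - b)^-1) <= D^-1 * modulus (f z).
  move=> zf; rewrite !modulusM modulusV modulusV -/D.
  rewrite ler_piMr ?mulr_ge0 ?invr_ge0 ?modulus_ge0//.
  have zb1 : 1 <= modulus (z - b) by apply: modulus_frame zf; lra.
  by rewrite invf_le1// (lt_le_trans ltr01).
have side (p q : R) (g : R -> R) (k : R -> R) : seg_cont p q g -> seg_cont p q k ->
    (forall t, p <= t <= q -> `|g t| <= D^-1 * k t) -> seg_int p q k <= T ->
    `|seg_int p q g| <= D^-1 * T.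
  move=> gc kc gk kT; rewrite (le_trans (seg_int_norm gc))//.
  apply: (@le_trans _ _ (seg_int p q (fun t => D^-1 * k t))).
    apply: le_seg_int => //; first exact: seg_cont_norm.
    by move=> t tp; apply: continuousM; [exact: cst_continuous|exact: kc].
  rewrite /seg_int RintegralZl//; last exact: seg_integrable.
  by rewrite ler_pM2l// invr_gt0.
have h1 := side _ _ _ _ (frame_cont_right x12 Fc) (@seg_cont_modulus_vert f x2 _ _ fe).
have h2 := side _ _ _ _ (frame_cont_left x12 Fc) (@seg_cont_modulus_vert f x1 _ _ fe).
have h3 := side _ _ _ _ (frame_cont_top y12 Fc) (@seg_cont_modulus_hor f y2 _ _ fe).
have h4 := side _ _ _ _ (frame_cont_bottom y12 Fc) (@seg_cont_modulus_hor f y1 _ _ fe).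
have {}h1 := h1 (fun t tp => le_trans (le_Re_modulus _) (bd _ (frame_right x12 tp))) t2.
have {}h2 := h2 (fun t tp => le_trans (le_Re_modulus _) (bd _ (frame_left x12 tp))) t1.
have {}h3 := h3 (fun t tp => le_trans (le_Im_modulus _) (bd _ (frame_top y12 tp))) t4.
have {}h4 := h4 (fun t tp => le_trans (le_Im_modulus _) (bd _ (frame_bottom y12 tp))) t3.
rewrite /rect_int => H.
have : 1 <= 4 * (D^-1 * T).
  move: h1 h2 h3 h4; rewrite !ler_norml.
  by move=> /andP[? ?] /andP[? ?] /andP[? ?] /andP[? ?]; lra.
by rewrite mulrCA mulrC ler_pdivlMr// mul1r.
Qed.

Lemma cdiffD f g b d d' : cdiff f b d -> cdiff g b d' -> cdiff (fun z => f z + g z) b (d + d').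
Proof.
move=> fd gd e e0; have e20 : 0 < e / 2 by rewrite divr_gt0.
have [r r0 H] := fd _ e20; have [r' r'0 H'] := gd _ e20.
exists (Num.min r r'); first by rewrite lt_min r0.
move=> h; rewrite lt_min => /andP[/H h1 /H' h2].
rewrite (_ : _ - _ = (f (b + h) - f b - d * h) + (g (b + h) - g b - d' * h)); last by ring.
by rewrite (le_trans (le_modulusD _ _))//; lra.
Qed.

Lemma cdiffZ f b d c : cdiff f b d -> cdiff (fun z => c * f z) b (c * d).
Proof.
move=> fd e e0.
have c0 : 0 < 1 + modulus c by rewrite ltr_pwDl ?modulus_ge0.
have [r r0 H] := fd (e / (1 + modulus c)) (divr_gt0 e0 c0).
exists r => // h /H Hh.
rewrite -mulrA -!mulrBr modulusM.
apply: (@le_trans _ _ (modulus c * (e / (1 + modulus c) * modulus h))).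
  by rewrite ler_wpM2l ?modulus_ge0.
rewrite !mulrA ler_wpM2r ?modulus_ge0// ler_pdivrMr// mulrC ler_wpM2l ?ltW//.
by rewrite ltrDr.
Qed.

(* The boundary of the square has length 12 and distance at least 1 to a and b:
   24 = 2 * (1 + 1) * 6 and 888 = 2 * (1 + 1 + 3 * 24) * 6, the factor 2 coming
   from rect_int_bound. *)
Section square.
Variables (f : R[i] -> R[i]) (a b : R[i]) (M : R).
Hypotheses (fe : entire f) (fM : forall z, modulus (z - b) <= 3 -> modulus (f z) <= M).
Hypothesis ab : modulus (a - b) <= 1 / 2.

(** With half-side 3 / 2 and |a - b| <= 1 / 2, both a and b have distance between 1 and 2 to the
    four side lines, as [rect_int_cauchy_ge1] requires, and the square lies in the disc of radius 3
    around b. *)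
Let x1 := Re b - 3 / 2. Let x2 := Re b + 3 / 2.
Let y1 := Im b - 3 / 2. Let y2 := Im b + 3 / 2.
Let x12 : x1 <= x2. Proof. by rewrite /x1 /x2; lra. Qed.
Let y12 : y1 <= y2. Proof. by rewrite /y1 /y2; lra. Qed.
Let bx : x1 < Re b < x2. Proof. by rewrite /x1 /x2; apply/andP; split; lra. Qed.
Let by_ : y1 < Im b < y2. Proof. by rewrite /y1 /y2; apply/andP; split; lra. Qed.

Let adist : [/\ 1 <= Re a - x1 <= 2, 1 <= x2 - Re a <= 2,
  1 <= Im a - y1 <= 2 & 1 <= y2 - Im a <= 2].
Proof.
have := le_trans (le_Re_modulus _) ab; have := le_trans (le_Im_modulus _) ab.
rewrite !raddfB !ler_norml /= => /andP[? ?] /andP[? ?].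
by rewrite /x1 /x2 /y1 /y2; split; apply/andP; split; lra.
Qed.

Let frame_b z : frame x1 x2 y1 y2 z -> 1 <= modulus (z - b) <= 3.
Proof.
move=> zf; apply/andP; split.
  by apply: modulus_frame zf; rewrite /x1 /x2 /y1 /y2; lra.
case: zf => -[/andP[]]; rewrite /x1 /x2 /y1 /y2 => ? ? /andP[? ?] _.
rewrite (le_trans (modulus_le_ReIm _))// [leRHS](_ : _ = 3 / 2 + 3 / 2); last by field.
by apply: lerD; rewrite raddfB ler_norml /=; apply/andP; split; lra.
Qed.

Let frame_a z : frame x1 x2 y1 y2 z -> 1 <= modulus (z - a).
Proof.
by case: adist => /andP[? ?] /andP[? ?] /andP[? ?] /andP[? ?]; exact: modulus_frame.
Qed.

Let ax : x1 < Re a < x2.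
Proof. by case: adist => /andP[? ?] /andP[? ?] _ _; apply/andP; split; lra. Qed.
Let ay : y1 < Im a < y2.
Proof. by case: adist => _ _ /andP[? ?] /andP[? ?]; apply/andP; split; lra. Qed.

(** F = (f - f b) / (f a - f b) is 1 at a and 0 at b, so F / (z - b) may be subtracted from F / (z -
    a) without changing the integral. The difference of the kernels is (a - b) / ((z - a) (z - b)),
    which brings out the factor a - b. *)
Lemma entire_lipschitz : modulus (f a - f b) <= 24 * M * modulus (a - b).
Proof.
have [E|ne] := eqVneq (f a - f b) 0.
  rewrite E modulus0 !mulr_ge0 ?modulus_ge0//.
  by rewrite (le_trans (modulus_ge0 (f b)))// fM// subrr modulus0.
set D := modulus (f a - f b).
have D0 : 0 < D by rewrite modulus_gt0.
pose F z := (f a - f b)^-1 * (f z + (- f b)).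
have Fe : entire F by exact: (@entire_scale _ (f a - f b)^-1 (entireD fe (@entire_cst R (- f b)))).
have Fa : F a = 1 by rewrite /F mulVf.
have Fb : F b = 0 by rewrite /F subrr mulr0.
have NFe : entire (fun z => (-1) * F z) by exact: (@entire_scale F (-1) Fe).
have H1 : 1 <= rect_int (fun z => F z * (z - a)^-1) x1 x2 y1 y2.
  by case: adist => *; exact: rect_int_cauchy_ge1.
have H2 : rect_int (fun z => (-1 * F z) * (z - b)^-1) x1 x2 y1 y2 = 0.
  by apply: rect_int_div_sub_eq0 => //; rewrite Fb mulr0.
rewrite -[rect_int _ _ _ _ _]addr0 -{1}H2 -rect_intD// in H1; last 2 first.
- by move=> z /(frame_neq ax ay); exact: ccont_div_sub.
- by move=> z /(frame_neq bx by_); exact: ccont_div_sub.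
have bd z : frame x1 x2 y1 y2 z ->
    modulus (F z * (z - a)^-1 + (-1 * F z) * (z - b)^-1) <= D^-1 * (2 * M) * modulus (a - b).
  move=> zf; have /andP[zb1 zb3] := frame_b zf; have za1 := frame_a zf.
  have za0 : z - a != 0 by rewrite -modulus_gt0; lra.
  have zb0 : z - b != 0 by rewrite -modulus_gt0; lra.
  rewrite (_ : _ + _ = F z * (a - b) * ((z - a)^-1 * (z - b)^-1)); last by field; apply/andP.
  rewrite !modulusM !modulusV -/D.
  apply: (@le_trans _ _ (D^-1 * modulus (f z - f b) * modulus (a - b) * 1)).
    rewrite ler_wpM2l ?mulr_ge0 ?invr_ge0 ?modulus_ge0//.
    by rewrite mulr_ile1 ?invr_ge0 ?modulus_ge0// invf_le1//; lra.
  rewrite mulr1 ler_wpM2r ?modulus_ge0// ler_wpM2l ?invr_ge0 ?modulus_ge0//.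
  rewrite (le_trans (le_modulusB _ _))// [2 * M](_ : _ = M + M); last by ring.
  by apply: lerD; apply: fM => //; rewrite subrr modulus0.
have cc z : frame x1 x2 y1 y2 z -> ccont (fun z => F z * (z - a)^-1 + (-1 * F z) * (z - b)^-1) z.
  move=> zf; have za := frame_neq ax ay zf; have zb := frame_neq bx by_ zf.
  have /derivable_cdiff[d1 h1] := derivable_div_sub Fe za.
  have /derivable_cdiff[d2 h2] := derivable_div_sub NFe zb.
  exact: cdiff_ccont (cdiffD h1 h2).
have := le_trans H1 (le_trans (ler_norm _) (rect_int_bound x12 y12 cc bd)).
rewrite (_ : 2 * (D^-1 * (2 * M) * modulus (a - b)) * (x2 - x1 + (y2 - y1)) =
  D^-1 * (24 * M * modulus (a - b))); last first.
  by rewrite /x1 /x2 /y1 /y2; field; rewrite gt_eqF.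
by rewrite mulrC ler_pdivlMr// mul1r.
Qed.

(** The same device for the first-order remainder G, which has a double zero at b: the null term (a
    - b) F / (z - b)^2 may be subtracted as well, and the kernel becomes (a - b)^2 / ((z - a) (z -
    b)^2). The bound on [d] is the one that [cdiff_bound] provides. *)
Lemma entire_taylor2 d : cdiff f b d -> modulus d <= 24 * M ->
  modulus (f a - f b - d * (a - b)) <= 888 * M * modulus (a - b) ^+ 2.
Proof.
move=> fd dM.
have M0 : 0 <= M by rewrite (le_trans (modulus_ge0 (f b)))// fM// subrr modulus0.
pose G z := f z + ((d * b - f b) + (- d) * z).
have Ge : entire G by exact: (entireD fe (@entire_affine R (d * b - f b) (- d))).
have Gb : G b = 0 by rewrite /G; ring.
have -> : f a - f b - d * (a - b) = G a by rewrite /G; ring.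
have Gd : cdiff G b 0.
  rewrite -(subrr d); apply: cdiffD => // e e0; exists 1 => // h _.
  by rewrite (_ : _ - _ = 0) ?modulus0 ?mulr_ge0 ?modulus_ge0 ?ltW//; ring.
have [E|ne] := eqVneq (G a) 0.
  rewrite E modulus0; apply: mulr_ge0; last by rewrite exprn_ge0 ?modulus_ge0.
  exact: (mulr_ge0 (ler0n _ _) M0).
set D := modulus (G a).
have D0 : 0 < D by rewrite modulus_gt0.
pose F z := (G a)^-1 * G z.
have Fe : entire F by exact: (@entire_scale G (G a)^-1 Ge).
have Fa : F a = 1 by rewrite /F mulVf.
have Fb : F b = 0 by rewrite /F Gb mulr0.
have NFe : entire (fun z => (-1) * F z) by exact: (@entire_scale F (-1) Fe).
have N2Fe : entire (fun z => (b - a) * F z) by exact: (@entire_scale F (b - a) Fe).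
have H1 : 1 <= rect_int (fun z => F z * (z - a)^-1) x1 x2 y1 y2.
  by case: adist => *; exact: rect_int_cauchy_ge1.
have H2 : rect_int (fun z => (-1 * F z) * (z - b)^-1) x1 x2 y1 y2 = 0.
  by apply: rect_int_div_sub_eq0 => //; rewrite Fb mulr0.
have H3 : rect_int (fun z => ((b - a) * F z) * (z - b)^-1 * (z - b)^-1) x1 x2 y1 y2 = 0.
  apply: rect_int_div_sub2_eq0 => //; first by rewrite Fb mulr0.
  rewrite -(mulr0 (b - a)); apply: cdiffZ; rewrite -(mulr0 (G a)^-1); exact: cdiffZ.
have c12 z : frame x1 x2 y1 y2 z -> ccont (fun z => F z * (z - a)^-1 + (-1 * F z) * (z - b)^-1) z.
  move=> zf; have za := frame_neq ax ay zf; have zb := frame_neq bx by_ zf.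
  have /derivable_cdiff[d1 h1] := derivable_div_sub Fe za.
  have /derivable_cdiff[d2 h2] := derivable_div_sub NFe zb.
  exact: cdiff_ccont (cdiffD h1 h2).
have cc z : frame x1 x2 y1 y2 z -> ccont (fun z => F z * (z - a)^-1 + (-1 * F z) * (z - b)^-1 +
    ((b - a) * F z) * (z - b)^-1 * (z - b)^-1) z.
  move=> zf; have za := frame_neq ax ay zf; have zb := frame_neq bx by_ zf.
  have /derivable_cdiff[d1 h1] := derivable_div_sub Fe za.
  have /derivable_cdiff[d2 h2] := derivable_div_sub NFe zb.
  have /derivable_cdiff[d3 h3] := derivable_div_sub2 N2Fe zb.
  exact: cdiff_ccont (cdiffD (cdiffD h1 h2) h3).
rewrite -[rect_int _ _ _ _ _]addr0 -{1}H2 -rect_intD// in H1; last 2 first.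
- by move=> z /(frame_neq ax ay); exact: ccont_div_sub.
- by move=> z /(frame_neq bx by_); exact: ccont_div_sub.
rewrite -[rect_int _ _ _ _ _]addr0 -{1}H3 -rect_intD// in H1; last first.
  by move=> z /(frame_neq bx by_); exact: ccont_div_sub2.
have bd z : frame x1 x2 y1 y2 z -> modulus (F z * (z - a)^-1 + (-1 * F z) * (z - b)^-1 +
    ((b - a) * F z) * (z - b)^-1 * (z - b)^-1) <= D^-1 * (74 * M) * modulus (a - b) ^+ 2.
  move=> zf; have /andP[zb1 zb3] := frame_b zf; have za1 := frame_a zf.
  have za0 : z - a != 0 by rewrite -modulus_gt0; lra.
  have zb0 : z - b != 0 by rewrite -modulus_gt0; lra.
  rewrite (_ : _ + _ = F z * (a - b) ^+ 2 * ((z - a)^-1 * ((z - b)^-1 * (z - b)^-1)));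
    last by field; apply/andP.
  rewrite !modulusM !modulusV -/D.
  apply: (@le_trans _ _ (D^-1 * modulus (G z) * modulus (a - b) ^+ 2 * 1)).
    rewrite expr2.
    rewrite ler_wpM2l ?mulr_ge0 ?invr_ge0 ?modulus_ge0//.
    by rewrite !mulr_ile1 ?mulr_ge0 ?invr_ge0 ?modulus_ge0// invf_le1//; lra.
  rewrite mulr1 ler_wpM2r ?exprn_ge0 ?modulus_ge0// ler_wpM2l ?invr_ge0 ?modulus_ge0//.
  rewrite (_ : G z = (f z - f b) - d * (z - b)); last by rewrite /G; ring.
  rewrite (le_trans (le_modulusB _ _))// (_ : 74 * M = (M + M) + 24 * M * 3); last by ring.
  apply: lerD.
    rewrite (le_trans (le_modulusB _ _))//.
    by apply: lerD; apply: fM => //; rewrite subrr modulus0.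
  by rewrite modulusM ler_pM ?modulus_ge0.
have := le_trans H1 (le_trans (ler_norm _) (rect_int_bound x12 y12 cc bd)).
rewrite (_ : 2 * (D^-1 * (74 * M) * modulus (a - b) ^+ 2) * (x2 - x1 + (y2 - y1)) =
  D^-1 * (888 * M * modulus (a - b) ^+ 2)); last first.
  by rewrite /x1 /x2 /y1 /y2; field; rewrite gt_eqF.
by rewrite mulrC ler_pdivlMr// mul1r.
Qed.

End square.

Lemma cdiff_bound f b d M : entire f ->
  (forall z, modulus (z - b) <= 3 -> modulus (f z) <= M) -> cdiff f b d ->
  modulus d <= 24 * M.
Proof.
move=> fe fM fd; apply/ler_addgt0Pr => e e0; have [r r0 H] := fd _ e0.
pose h : R := Num.min (1 / 2) (r / 2).
have h0 : 0 < h by rewrite lt_min !divr_gt0.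
have h12 : h <= 1 / 2 by rewrite ge_min lexx.
have hr : h < r by rewrite gt_min; apply/orP; right; lra.
have mh : modulus h%:C = h by rewrite modulus_real gtr0_norm.
have := H h%:C; rewrite mh => /(_ hr) H1.
have := @entire_lipschitz f (b + h%:C) b M fe fM.
rewrite addrAC subrr add0r mh => /(_ h12) H2.
rewrite -(ler_pM2r h0) -{1}mh -modulusM mulrDl.
rewrite (_ : d * _ = (f (b + h%:C) - f b) - (f (b + h%:C) - f b - d * h%:C)); last by ring.
by rewrite (le_trans (le_modulusB _ _))// lerD.
Qed.

End CauchyEstimates.

(** * The complex exponential *)

Section ComplexExponential.
Context {R : realType}.
Implicit Types (z w h : R[i]).

Lemma is_derive_expansion (f : R -> R) (x d : R) : is_derive x 1 f d ->
  forall e, 0 < e -> exists2 r, 0 < r & forall h : R, `|h| < r ->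
    `|f (x + h) - f x - d * h| <= e * `|h|.
Proof.
move=> [/= fx fd] e e0.
have /cvgrPdist_le/(_ e e0) : h^-1 *: (f (h *: 1 + x) - f x) @[h --> 0^'] --> d.
  by rewrite -fd; exact: fx.
case/nbhs_ballP => r /= r0 H; exists r => // h hr.
have [->|h0] := eqVneq h 0; first by rewrite addr0 mulr0 !subrr normr0 mulr0.
have := H h; rewrite -ball_normE /= sub0r normrN => /(_ hr h0).
move=> /(ler_wpM2r (normr_ge0 h)); rewrite -normrM mulrBl mulrAC.
by rewrite /GRing.scale/= mulVf// mul1r mulr1 distrC [h + x]addrC; apply.
Qed.

Definition cexp z : R[i] :=
  (expR (Re z) * cos (Im z)) +i* (expR (Re z) * sin (Im z)).

Lemma modulus_cexp z : modulus (cexp z) = expR (Re z).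
Proof.
rewrite /cexp modulusE !exprMn -mulrDr cos2Dsin2 mulr1 sqrtr_sqr.
by rewrite ger0_norm// expR_ge0.
Qed.

Lemma cexpD z w : cexp (z + w) = cexp z * cexp w.
Proof.
rewrite /cexp !raddfD /= expRD cosD sinD.
by apply/eqP; rewrite eq_complex /=; apply/andP; split; apply/eqP; ring.
Qed.

Lemma cexp0 : cexp 0 = 1.
Proof. by rewrite /cexp /= expR0 cos0 sin0 mulr1 mulr0. Qed.

Lemma cexp_cdiff0 : cdiff cexp 0 1.
Proof.
(* The four error terms [b1] to [b4] amount to 2 + 1 + 2 + 1 = 6 multiples of e6 |h|; the bound e6
   <= 1 gives e^x <= 2. *)
move=> e e0; pose e6 := Num.min 1 (e / 6).
have e60 : 0 < e6 by rewrite lt_min ltr01 divr_gt0.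
have e61 : e6 <= 1 by rewrite ge_min lexx.
have e66 : e6 <= e / 6 by rewrite ge_min lexx orbT.
have [r1 r10 H1] := is_derive_expansion (is_derive_expR (0 : R)) e60.
have [r2 r20 H2] := is_derive_expansion (is_derive_cos (0 : R)) e60.
have [r3 r30 H3] := is_derive_expansion (is_derive_sin (0 : R)) e60.
exists (Num.min (Num.min r1 (e6 / 2)) (Num.min r2 r3)).
  by rewrite !lt_min r10 r20 r30 divr_gt0.
move=> h; rewrite !lt_min => /andP[/andP[h1 h4] /andP[h2 h3]].
have hx := le_Re_modulus h; have hy := le_Im_modulus h.
have {H1} := H1 _ (le_lt_trans hx h1); have {H2} := H2 _ (le_lt_trans hy h2).
have {H3} := H3 _ (le_lt_trans hy h3).
rewrite !add0r expR0 cos0 sin0 oppr0 mul0r !addr0 !subr0 !mul1r cexp0 => H3 H2 H1.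
set x := Re h in hx H1 *; set y := Im h in hy H2 H3 *.
have ex1 : `|expR x - 1| <= e6.
  rewrite -[X in `|X|](subrK x) (le_trans (ler_normD _ _))//.
  have : e6 * `|x| <= `|x| by rewrite ler_piMl.
  lra.
have ex2 : `|expR x| <= 2.
  rewrite -[X in `|X|](subrK 1) (le_trans (ler_normD _ _))// normr1; lra.
rewrite (le_trans (modulus_le_ReIm _))//.
rewrite (_ : Re _ = expR x * (cos y - 1) + (expR x - 1 - x)); last first.
  by rewrite /x /y; case: (h) => a b /=; ring.
rewrite (_ : Im _ = expR x * (sin y - y) + (expR x - 1) * y); last first.
  by rewrite /x /y; case: (h) => a b /=; ring.
have m0 := modulus_ge0 h.
have b1 : `|expR x * (cos y - 1)| <= 2 * (e6 * modulus h).
  rewrite normrM ler_pM// (le_trans H2)// ler_wpM2l// ltW//.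
have b2 : `|expR x - 1 - x| <= e6 * modulus h.
  by rewrite (le_trans H1)// ler_wpM2l// ltW//.
have b3 : `|expR x * (sin y - y)| <= 2 * (e6 * modulus h).
  rewrite normrM ler_pM// (le_trans H3)// ler_wpM2l// ltW//.
have b4 : `|(expR x - 1) * y| <= e6 * modulus h.
  by rewrite normrM ler_pM.
have b5 : e6 * modulus h <= e / 6 * modulus h by rewrite ler_wpM2r.
have := ler_normD (expR x * (cos y - 1)) (expR x - 1 - x).
have := ler_normD (expR x * (sin y - y)) ((expR x - 1) * y).
lra.
Qed.

Lemma entire_cexp : entire cexp.
Proof.
apply/entireP => z; exists (cexp z) => e e0.
have [r r0 H] := cexp_cdiff0 (divr_gt0 e0 (expR_gt0 (Re z))).
exists r => // h /H; rewrite add0r cexp0 mul1r => Hh.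
rewrite cexpD (_ : _ - _ = cexp z * (cexp h - 1 - h)); last by ring.
rewrite modulusM modulus_cexp mulrC -ler_pdivlMr ?expR_gt0//.
by rewrite mulrAC.
Qed.

End ComplexExponential.

(** * Gaussian weights and Fock norms *)

Section Measurability.
Context {R : realType}.
Implicit Types (f : R[i] -> R[i]).

(** Rounding the first variable down to multiples of 1 / (n + 1) gives functions that are measurable
    on each of countably many vertical strips; by continuity in the first variable they converge
    pointwise to g. *)
Lemma measurable_fun_separately_continuous (g : R -> R -> R) :
  (forall x, measurable_fun setT (g x)) -> (forall y, continuous (g^~ y)) ->
  measurable_fun setT (fun w : R * R => g w.1 w.2).
Proof.
move=> gm gc.
pose c n : R := n.+1%:R.
have c0 n : 0 < c n by rewrite ltr0n.
apply: (@measurable_fun_cvg _ _ _ _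
  (fun n (w : R * R) => g ((Num.floor (c n * w.1))%:~R / c n) w.2)).
- move=> n _ Y mY; rewrite setTI.
  have -> : (fun w : R * R => g ((Num.floor (c n * w.1))%:~R / c n) w.2) @^-1` Y =
    \bigcup_(k : int) (`[k%:~R / c n, (k + 1)%:~R / c n[%classic `*` (g (k%:~R / c n) @^-1` Y)).
    apply/seteqP; split=> [[x y] /= Yxy|[x y] [k _ /=]].
      exists (Num.floor (c n * x)) => //=; split => //=.
      rewrite in_itv /= ler_pdivrMr// ltr_pdivlMr// ![x * _]mulrC.
      exact: Num.Theory.floor_itv.
    rewrite in_itv /= ler_pdivrMr// ltr_pdivlMr// ![x * _]mulrC => -[kx].
    by rewrite -Num.Theory.floor_eq in kx; rewrite (eqP kx).
  apply: countable_bigcupT_measurable => // k.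
  apply: measurableX; first exact: measurable_itv.
  by rewrite -[X in measurable X]setTI; exact: gm.
- move=> [x y] _ /=; apply: (@cvg_comp _ _ _ _ (g^~ y)); last exact: gc.
  apply/cvgrPdist_le => e e0.
  have /cvgrPdist_le/(_ e e0) := @cvg_harmonic R.
  apply: filterS => n; rewrite sub0r normrN /= => H; apply: le_trans H.
  have /andP[f1 f2] := Num.Theory.floor_itv (c n * x).
  rewrite [leRHS]ger0_norm ?invr_ge0// -/(c n).
  rewrite (_ : x - _ = (c n * x - (Num.floor (c n * x))%:~R) / c n); last first.
    by field; rewrite gt_eqF.
  rewrite normrM [X in _ * X]gtr0_norm ?invr_gt0// ler_piMl ?invr_ge0 ?ltW//.
  rewrite intrD in f2; rewrite ger0_norm ?subr_ge0//.
  lra.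
Qed.

Lemma continuous_modulus_vert f x : entire f -> continuous (fun y => modulus (f (x +i* y))).
Proof. by move=> fe y; apply: (@seg_cont_modulus_vert _ f x y y fe); rewrite lexx. Qed.

Lemma continuous_modulus_hor f y : entire f -> continuous (fun x => modulus (f (x +i* y))).
Proof. by move=> fe x; apply: (@seg_cont_modulus_hor _ f y x x fe); rewrite lexx. Qed.

Lemma measurable_modulus f : entire f ->
  measurable_fun setT (fun w : R * R => modulus (f (w.1 +i* w.2))).
Proof.
move=> fe; apply: (@measurable_fun_separately_continuous (fun x y => modulus (f (x +i* y)))).
  by move=> x; apply: continuous_measurable_fun; exact: continuous_modulus_vert.
by move=> y; exact: continuous_modulus_hor.
Qed.

Lemma measurable_gauss_weight (c : R) :
  measurable_fun setT (fun w : R * R => gauss_weight c (w.1 +i* w.2)).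
Proof.
rewrite /gauss_weight; apply: measurableT_comp => //; apply: measurable_funM => //.
by apply: measurable_funX; exact: (measurable_modulus (@entire_id R)).
Qed.

Definition fock_density (c q : R) f (w : R * R) : R :=
  modulus (f (w.1 +i* w.2)) `^ q * gauss_weight c (w.1 +i* w.2).

Lemma fock_density_ge0 c q f w : 0 <= fock_density c q f w.
Proof. by rewrite mulr_ge0 ?powR_ge0// expR_ge0. Qed.

Lemma measurable_fock_density c q f : entire f ->
  measurable_fun setT (fock_density c q f).
Proof.
move=> fe; apply: measurable_funM; last exact: measurable_gauss_weight.
exact: (measurableT_comp (@measurable_powR R q) (measurable_modulus fe)).
Qed.

End Measurability.

(** * Lines with small section integrals *)

Section Sections.
Context {R : realType}.
Local Notation mu := (@lebesgue_measure R).
Local Open Scope ereal_scope.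

(** Markov's inequality on an interval of length 1: if g were at least t throughout, its integral
    would be at least t. This selects the sides of the contour. *)
Lemma exists_small_value (g : R -> \bar R) (a t : R) : measurable_fun setT g ->
  (forall x, 0 <= g x) -> \int[mu]_x g x < t%:E ->
  exists2 x, (a <= x <= a + 1)%R & g x < t%:E.
Proof.
move=> mg g0 gt; apply: contrapT => H.
have {}H x : `[a, (a + 1)%R]%classic x -> t%:E <= g x.
  rewrite /= in_itv /= => xa; rewrite leNgt; apply/negP => gx; apply: H; by exists x.
have t0 : (0 <= t)%R by rewrite -lee_fin (le_trans _ (ltW gt))// integral_ge0.
have : t%:E <= \int[mu]_x g x.
  apply: (@le_trans _ _ (\int[mu]_(x in `[a, (a + 1)%R]) g x)); last first.
    by apply: ge0_subset_integral.
  apply: (@le_trans _ _ (\int[mu]_(x in `[a, (a + 1)%R]) (cst t%:E x))).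
    rewrite integral_cst//= lebesgue_measure_itv/= lte_fin ltrDl ltr01.
    by rewrite -EFinD addrAC subrr add0r mule1.
  by apply: ge0_le_integral => //; exact: measurable_funTS.
by rewrite leNgt gt.
Qed.

(** The form 1 + K phi comes from v <= 1 + v^q, which stands in for Hoelder's inequality in the
    passage from a q-th power to an integral of h itself. *)
Lemma seg_int_le_density (p q K T : R) (phi h : R -> R) : (p <= q)%R -> (0 <= K)%R ->
  measurable_fun setT phi -> (forall x, 0 <= phi x)%R ->
  \int[mu]_x (phi x)%:E < T%:E -> seg_cont p q h ->
  (forall x, p <= x <= q -> 0 <= h x <= 1 + K * phi x)%R ->
  (seg_int p q h <= (q - p) + K * T)%R.
Proof.
move=> pq K0 mphi phi0 phiT hc hK.
have mphiE (D : set R) : measurable_fun D (EFin \o phi).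
  by apply/measurable_EFinP; exact: measurable_funTS.
have mKphi (D : set R) : measurable_fun D (fun x => K%:E * (phi x)%:E).
  have mK : measurable_fun D (fun x => K * phi x)%R.
    by apply: measurable_funM => //; exact: measurable_funTS.
  rewrite (_ : (fun x => _) = EFin \o (fun x => K * phi x)%R)//.
  exact/measurable_EFinP.
have m1Kphi (D : set R) : measurable_fun D (fun x => 1%:E + K%:E * (phi x)%:E).
  have mK : measurable_fun D (fun x => 1 + K * phi x)%R.
    by apply: measurable_funD => //; apply: measurable_funM => //; exact: measurable_funTS.
  rewrite (_ : (fun x => _) = EFin \o (fun x => 1 + K * phi x)%R)//.
  exact/measurable_EFinP.
rewrite -lee_fin /seg_int /Rintegral fineK; last first.
  by apply: integrable_fin_num => //; exact: seg_integrable.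
apply: (@le_trans _ _ (\int[mu]_(x in `[p, q]) (1%:E + K%:E * (phi x)%:E))).
  apply: ge0_le_integral => //.
  - by move=> x /=; rewrite ?in_itv /= => /hK/andP[]; rewrite lee_fin.
  - exact: measurable_int (seg_integrable hc).
  - exact: m1Kphi.
  - by move=> x /=; rewrite ?in_itv /= => /hK/andP[]; rewrite -EFinM -EFinD lee_fin.
rewrite ge0_integralD//; last 2 first.
- by move=> x _; rewrite -EFinM lee_fin mulr_ge0.
- exact: mKphi.
rewrite ge0_integralZl_EFin//; last exact: mphiE.
rewrite integral_cst//= lebesgue_measure_itv/= lte_fin mul1e EFinD.
apply: leeD.
  by case: ltP => // qp; rewrite lee_fin subr_ge0.
rewrite EFinM lee_wpmul2l ?lee_fin// (le_trans _ (ltW phiT))//.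
apply: ge0_subset_integral => //; [exact: mphiE|by move=> x _; rewrite lee_fin].
by move=> x _; rewrite lee_fin.
Qed.

End Sections.

(** * Gaussian integrals *)

Section GaussianIntegral.
Context {R : realType}.
Local Notation mu := (@lebesgue_measure R).

(** For k > 0 this is sqrt(pi / k), read off from the normal density of variance 1 / (2 k). *)
Definition gauss_mass (k : R) : R := (normal_peak (Num.sqrt (k *+ 2)^-1))^-1.

Lemma gauss_mass_ge0 k : 0 <= gauss_mass k.
Proof. by rewrite invr_ge0 normal_peak_ge0. Qed.

Lemma integral_gauss1 (k m : R) : 0 < k ->
  (\int[mu]_x (expR (- k * (x - m) ^+ 2))%:E = (gauss_mass k)%:E)%E.
Proof.
move=> k0; set s := Num.sqrt (k *+ 2)^-1.
have s0 : s != 0 by rewrite gt_eqF// sqrtr_gt0 invr_gt0 mulrn_wgt0.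
have p0 := normal_peak_gt0 s0.
have ss : s ^+ 2 = (k *+ 2)^-1 by rewrite sqr_sqrtr// invr_ge0 mulrn_wge0// ltW.
transitivity (\int[mu]_x ((normal_peak s)^-1%:E * (normal_pdf m s x)%:E))%E.
  apply: eq_integral => x _; rewrite -EFinM normal_pdfE//=; congr (_%:E).
  rewrite [RHS]mulrA mulVf ?gt_eqF// mul1r /normal_fun ss; congr expR.
  by field; rewrite gt_eqF.
rewrite ge0_integralZl_EFin//.
- by rewrite integral_normal_pdf mule1.
- by move=> x _; rewrite lee_fin normal_pdf_ge0.
- by apply/measurable_EFinP; exact: measurable_normal_pdf.
- by rewrite invr_ge0 ltW.
Qed.

Lemma measurable_gauss_shift (k : R) (m : R[i]) :
  measurable_fun setT (fun w : R * R => gauss_weight k (w.1 +i* w.2 - m)).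
Proof.
rewrite /gauss_weight; apply: measurableT_comp => //; apply: measurable_funM => //.
apply: measurable_funX.
exact: (measurable_modulus (entireD (@entire_id R) (@entire_cst R (- m)))).
Qed.

Lemma integral_gauss2 (k : R) (m : R[i]) : 0 < k ->
  (\int[mu \x mu]_w (gauss_weight k (w.1 +i* w.2 - m))%:E =
   (gauss_mass k ^+ 2)%:E)%E.
Proof.
move=> k0.
have Mx : measurable_fun setT (fun w : R * R => (gauss_weight k (w.1 +i* w.2 - m))%:E).
  by apply/measurable_EFinP; exact: measurable_gauss_shift.
have M0 (w : R * R) : (0 <= (gauss_weight k (w.1 +i* w.2 - m))%:E)%E.
  by rewrite lee_fin expR_ge0.
rewrite [LHS](@fubini_tonelli1 _ _ _ _ R mu mu _ Mx M0).
transitivity (\int[mu]_x ((gauss_mass k)%:E * (expR (- k * (x - Re m) ^+ 2))%:E))%E.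
  apply: eq_integral => x _; rewrite /fubini_F /=.
  transitivity (\int[mu]_y ((expR (- k * (x - Re m) ^+ 2))%:E *
      (expR (- k * (y - Im m) ^+ 2))%:E))%E.
    apply: eq_integral => y _; rewrite -EFinM -expRD; congr (expR _)%:E.
    by rewrite sqr_modulus complex_sub /=; ring.
  rewrite ge0_integralZl_EFin//; first by rewrite integral_gauss1// muleC.
  apply/measurable_EFinP; apply: measurableT_comp => //; apply: measurable_funM => //.
  by apply: measurable_funX; exact: measurable_funB.
rewrite ge0_integralZl_EFin//; [by rewrite integral_gauss1// -EFinM| |].
- apply/measurable_EFinP; apply: measurableT_comp => //; apply: measurable_funM => //.
  by apply: measurable_funX; exact: measurable_funB.
- exact: gauss_mass_ge0.
Qed.

End GaussianIntegral.

(** * Fock norms and pointwise bounds *)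

Section FockNorm.
Context {R : realType}.
Local Notation mu := (@lebesgue_measure R).
Implicit Types (f h : R[i] -> R[i]) (z m : R[i]).

Lemma gauss_weight_gt0 (c : R) z : 0 < gauss_weight c z.
Proof. exact: expR_gt0. Qed.

Lemma gauss_weight_ge0 (c : R) z : 0 <= gauss_weight c z.
Proof. exact: expR_ge0. Qed.

Lemma gauss_weight_le1 (c : R) z : 0 <= c -> gauss_weight c z <= 1.
Proof. by move=> c0; rewrite expR_le1 mulNr oppr_le0 mulr_ge0// sqr_ge0. Qed.

Lemma fock_norm_ge0 (alpha : R) (p : \bar R) f : (0 <= fock_norm alpha p f)%E.
Proof.
case: p => [q| |] //=; first exact: poweR_ge0.
apply: (@le_trans _ _ (modulus (f 0) * gauss_weight (alpha / 2) 0)%:E).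
  by rewrite lee_fin mulr_ge0 ?modulus_ge0// gauss_weight_ge0.
by apply: ereal_sup_ubound; exists 0.
Qed.

Lemma gauss_weight_powR (c q : R) z : gauss_weight c z `^ q = gauss_weight (c * q) z.
Proof. by rewrite /gauss_weight -expRM; congr expR; ring. Qed.

(** The q-th power of a Gaussian is an integrable Gaussian, and for p = +oo the Gaussian is at most
    1. That [K] is independent of the centre [m] makes the norms of the kernels bounded uniformly in
    w. *)
Lemma fock_norm_le_gauss (alpha delta : R) (p : \bar R) : 0 < alpha ->
  (1%:E <= p)%E -> 0 < delta ->
  exists2 K : R, 0 <= K & forall h m (e : R), entire h -> 0 <= e ->
    (forall z, modulus (h z) * gauss_weight (alpha / 2) z <=
               e * gauss_weight delta (z - m)) ->
    (fock_norm alpha p h <= (K * e)%:E)%E.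
Proof.
move=> al0 p1 de0; case: p p1 => [q| |] //; last first.
  move=> _; exists 1 => // h m e he e0 H /=; apply: ge_ereal_sup => _ [z _ <-].
  rewrite lee_fin mul1r (le_trans (H z))// ler_piMr//.
  exact: gauss_weight_le1 (ltW de0).
rewrite lee_fin => q1; have q0 : 0 < q by lra.
pose c := alpha * q / (2 * pi); have c0 : 0 < c.
  by rewrite divr_gt0 ?mulr_gt0 ?pi_gt0.
pose G := gauss_mass (delta * q) ^+ 2.
have G0 : 0 <= G by rewrite exprn_ge0// gauss_mass_ge0.
exists ((c * G) `^ q^-1); first exact: powR_ge0.
move=> h m e he e0 H; rewrite /fock_norm -/c.
have cG0 : 0 <= c * G by rewrite mulr_ge0// ltW.
have -> : (c * G) `^ q^-1 * e = (c * (e `^ q * G)) `^ q^-1.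
  rewrite [in RHS](mulrCA c) (powRM _ (powR_ge0 _ _) cG0).
  by rewrite -powRrM mulfV ?gt_eqF// powRr1// mulrC.
rewrite -poweR_EFin.
apply: gt0_ler_poweR; first by rewrite invr_ge0 ltW.
- rewrite in_itv /= leey andbT; apply: mule_ge0; first by rewrite lee_fin ltW.
  by apply: integral_ge0 => w _; rewrite lee_fin;
    exact: (@fock_density_ge0 R (alpha * q / 2) q h w).
- rewrite in_itv /= leey andbT lee_fin; apply: mulr_ge0; first exact: ltW.
  by apply: mulr_ge0; first exact: powR_ge0.
rewrite [leRHS]EFinM; apply: lee_wpmul2l; first by rewrite lee_fin ltW.
rewrite [leRHS]EFinM /G -(@integral_gauss2 _ _ m) ?mulr_gt0// -ge0_integralZl_EFin ?powR_ge0//.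
- apply: ge0_le_integral => //.
  + by move=> w _; rewrite lee_fin; exact: fock_density_ge0.
  + by apply/measurable_EFinP; exact: measurable_fock_density.
  + rewrite (_ : (fun x => _) =
        EFin \o (fun w => e `^ q * gauss_weight (delta * q) (w.1 +i* w.2 - m)))//.
    by apply/measurable_EFinP; apply: measurable_funM => //; exact: measurable_gauss_shift.
  + move=> w _; rewrite -EFinM lee_fin.
    rewrite (_ : alpha * q / 2 = alpha / 2 * q); last by field.
    rewrite -(gauss_weight_powR (alpha / 2) q) -(gauss_weight_powR delta q).
    rewrite -!powRM ?gauss_weight_ge0 ?modulus_ge0//.
    apply: ge0_ler_powR; rewrite ?nnegrE ?mulr_ge0 ?gauss_weight_ge0 ?modulus_ge0//.
    by lra.
- by move=> w _; rewrite lee_fin gauss_weight_ge0.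
- by apply/measurable_EFinP; exact: measurable_gauss_shift.
Qed.

Lemma gauss_weight_translate (alpha : R) z w :
  - (alpha * Re ((Re z +i* - Im z) * (w - z))) - alpha / 2 * modulus z ^+ 2 =
  - (alpha / 2) * modulus w ^+ 2 + alpha / 2 * modulus (w - z) ^+ 2.
Proof. by rewrite !sqr_modulus; case: z w => [a b] [c d] /=; field. Qed.

(* A Cauchy estimate on squares around z for the translate
   w |-> f(w) exp(-alpha conj(z) (w - z)), whose modulus is comparable near z
   to that of f(w) exp(-alpha |w|^2 / 2). *)
Lemma pointwise_density (alpha q T : R) f z : 0 < alpha -> 1 <= q -> 0 < T ->
  entire f ->
  (\int[mu \x mu]_w (fock_density (alpha * q / 2) q f w)%:E < (T `^ q)%:E)%E ->
  modulus (f z) * gauss_weight (alpha / 2) z <= 4 * (4 + expR (4 * alpha * q)) * T.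
Proof.
move=> al0 q1 T0 fe fT; have q0 : 0 < q by lra.
set Phi := fock_density _ _ _ in fT.
have mPhi : measurable_fun setT (EFin \o Phi).
  by apply/measurable_EFinP; exact: measurable_fock_density.
have Phi0 w : (0 <= (EFin \o Phi) w)%E by rewrite lee_fin fock_density_ge0.
have F0 x : (0 <= fubini_F mu (EFin \o Phi) x)%E by apply: integral_ge0.
have G0 x : (0 <= fubini_G mu (EFin \o Phi) x)%E by apply: integral_ge0.
have FT : (\int[mu]_x fubini_F mu (EFin \o Phi) x < (T `^ q)%:E)%E.
  by rewrite -(@fubini_tonelli1 _ _ _ _ R mu mu _ mPhi Phi0).
have GT : (\int[mu]_y fubini_G mu (EFin \o Phi) y < (T `^ q)%:E)%E.
  by rewrite -(@fubini_tonelli2 _ _ _ _ R mu mu _ mPhi Phi0).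
have mF : measurable_fun setT (fubini_F mu (EFin \o Phi)).
  exact: measurable_fun_fubini_tonelli_F.
have mG : measurable_fun setT (fubini_G mu (EFin \o Phi)).
  exact: measurable_fun_fubini_tonelli_G.
(* Two vertical and two horizontal lines at distance between 1 and 2 from z, on each of which the
   density has integral below T^q. *)
have [x1 /andP[x1l x1u] Fx1] := exists_small_value (Re z - 2) mF F0 FT.
have [x2 /andP[x2l x2u] Fx2] := exists_small_value (Re z + 1) mF F0 FT.
have [y1 /andP[y1l y1u] Gy1] := exists_small_value (Im z - 2) mG G0 GT.
have [y2 /andP[y2l y2u] Gy2] := exists_small_value (Im z + 1) mG G0 GT.
pose zc : R[i] := Re z +i* - Im z.
(* This factor makes |g z| the weighted modulus of f at z divided by T. *)
pose A : R := gauss_weight (alpha / 2) z / T.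
have A0 : 0 < A by rewrite divr_gt0// gauss_weight_gt0.
pose g w := A%:C * (f w * cexp ((alpha%:C * zc * z) + (- (alpha%:C * zc)) * w)).
have ge : entire g.
  exact: (@entire_scale _ _ A%:C (entireM fe (entire_comp entire_cexp
    (@entire_affine R (alpha%:C * zc * z) (- (alpha%:C * zc)))))).
have modg w : modulus (g w) = modulus (f w) * gauss_weight (alpha / 2) w *
    expR (alpha / 2 * modulus (w - z) ^+ 2) / T.
  rewrite /g !modulusM modulus_real gtr0_norm// modulus_cexp /A.
  rewrite (_ : Re _ = - (alpha * Re (zc * (w - z)))); last first.
    by rewrite /zc; case: (z) (w) => [? ?] [? ?] /=; ring.
  set X := expR _; set Y := expR _.
  have E : X * gauss_weight (alpha / 2) z = gauss_weight (alpha / 2) w * Y.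
    rewrite /X /Y /gauss_weight -!expRD; congr expR.
    by rewrite -gauss_weight_translate mulNr.
  rewrite [LHS](_ : _ = modulus (f w) * (X * gauss_weight (alpha / 2) z) / T).
    by rewrite E !mulrA.
  by field; rewrite gt_eqF.
(* On the square |w - z|^2 <= 8, so the q-th power of exp(alpha |w - z|^2 / 2) is at most exp(4
   alpha q). With sides of length at most 4, each side integral is then at most 4 + K T^q. *)
pose K := expR (4 * alpha * q) / T `^ q.
have Tq : 0 < T `^ q by rewrite powR_gt0.
have K0 : 0 <= K by rewrite divr_ge0 ?expR_ge0// ltW.
have gPhi (x y : R) : `|x - Re z| <= 2 -> `|y - Im z| <= 2 ->
    0 <= modulus (g (x +i* y)) <= 1 + K * Phi (x, y).
  move=> xz yz; rewrite modulus_ge0 /=; set v := modulus (g _).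
  have v0 : 0 <= v by exact: modulus_ge0.
  have : v <= 1 + v `^ q.
    have [v1|v1] := leP v 1; first by rewrite (le_trans v1)// lerDl powR_ge0.
    by rewrite (le_trans (le1r_powR (ltW v1) q1))// lerDr.
  move=> /le_trans; apply; rewrite lerD2l /v modg.
  have Ti : 0 <= T^-1 by rewrite invr_ge0 ltW.
  set d2 := modulus (_ - z) ^+ 2.
  have d28 : d2 <= 8.
    rewrite /d2 sqr_modulus complex_sub /=.
    move: xz yz; rewrite !ler_norml => /andP[? ?] /andP[? ?].
    have h1 : (x - Re z) ^+ 2 <= 4 by nra.
    have h2 : (y - Im z) ^+ 2 <= 4 by nra.
    lra.
  have f0 := modulus_ge0 (f (x +i* y)).
  have w0 := gauss_weight_ge0 (alpha / 2) (x +i* y).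
  have e0 := expR_ge0 (alpha / 2 * d2).
  rewrite (powRM q (mulr_ge0 (mulr_ge0 f0 w0) e0) Ti).
  rewrite (powRM q (mulr_ge0 f0 w0) e0) (powRM q f0 w0).
  rewrite gauss_weight_powR (_ : alpha / 2 * q = alpha * q / 2); last by field.
  rewrite -[_ * gauss_weight _ _]/(Phi (x, y)).
  have -> : T^-1 `^ q = (T `^ q)^-1.
    by rewrite -(powR_inv1 (ltW T0)) -powRrM mulN1r powRN.
  rewrite -expRM /K -mulrA [leRHS]mulrC.
  apply: (ler_wpM2l (fock_density_ge0 _ _ _ _)).
  apply: ler_wpM2r; first by rewrite invr_ge0 ltW.
  rewrite ler_expR (_ : alpha / 2 * d2 * q = alpha * q / 2 * d2); last by field.
  rewrite (_ : 4 * alpha * q = alpha * q / 2 * 8); last by field.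
  by apply: ler_wpM2l d28; rewrite divr_ge0// mulr_ge0 ?ltW.
have sl (p r : R) (phi k : R -> R) : p <= r <= p + 4 -> measurable_fun setT phi ->
    (forall x, 0 <= phi x) -> (\int[mu]_x (phi x)%:E < (T `^ q)%:E)%E ->
    seg_cont p r k -> (forall x, p <= x <= r -> 0 <= k x <= 1 + K * phi x) ->
    seg_int p r k <= 4 + expR (4 * alpha * q).
  move=> /andP[pr rp4] mphi phi0 phiT kc kphi.
  apply: le_trans (seg_int_le_density pr K0 mphi phi0 phiT kc kphi) _.
  by apply: lerD; [lra|rewrite /K -mulrA mulVf ?gt_eqF// mulr1].
have mphi : measurable_fun setT Phi by exact: measurable_fock_density.
have mP1 x : measurable_fun setT (fun y => Phi (x, y)).
  by apply: (measurableT_comp mphi); exact: pair1_measurable.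
have mP2 y : measurable_fun setT (fun x => Phi (x, y)).
  by apply: (measurableT_comp mphi); exact: pair2_measurable.
have nn (u v : R) : u - 2 <= v <= u + 2 -> `|v - u| <= 2.
  by move=> /andP[? ?]; rewrite ler_norml; apply/andP; split; lra.
have := @cauchy_side_estimate R g z x1 x2 y1 y2 (4 + expR (4 * alpha * q)) ge.
have -> : modulus (g z) = modulus (f z) * gauss_weight (alpha / 2) z / T.
  by rewrite modg subrr modulus0 expr0n mulr0 expR0 mulr1.
rewrite ler_pdivrMr//; apply; try by apply/andP; split; lra.
- apply: (sl y1 y2 (fun y => Phi (x1, y)) _ _ (mP1 x1) (fun y => fock_density_ge0 _ _ _ _)
    Fx1 (@seg_cont_modulus_vert _ g x1 _ _ ge)).
    by apply/andP; split; lra.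
  by move=> y /andP[? ?]; apply: gPhi; apply: nn; apply/andP; split; lra.
- apply: (sl y1 y2 (fun y => Phi (x2, y)) _ _ (mP1 x2) (fun y => fock_density_ge0 _ _ _ _)
    Fx2 (@seg_cont_modulus_vert _ g x2 _ _ ge)).
    by apply/andP; split; lra.
  by move=> y /andP[? ?]; apply: gPhi; apply: nn; apply/andP; split; lra.
- apply: (sl x1 x2 (fun y => Phi (y, y1)) _ _ (mP2 y1) (fun y => fock_density_ge0 _ _ _ _)
    Gy1 (@seg_cont_modulus_hor _ g y1 _ _ ge)).
    by apply/andP; split; lra.
  by move=> y /andP[? ?]; apply: gPhi; apply: nn; apply/andP; split; lra.
- apply: (sl x1 x2 (fun y => Phi (y, y2)) _ _ (mP2 y2) (fun y => fock_density_ge0 _ _ _ _)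
    Gy2 (@seg_cont_modulus_hor _ g y2 _ _ ge)).
    by apply/andP; split; lra.
  by move=> y /andP[? ?]; apply: gPhi; apply: nn; apply/andP; split; lra.
Qed.

(** Uniformity over a ball of the norm is what both directions of the theorem use; how [B] depends
    on [M] does not matter. *)
Lemma fock_norm_pointwise (alpha M : R) (p : \bar R) : 0 < alpha -> (1%:E <= p)%E ->
  exists2 B : R, 0 <= B & forall f z, entire f -> (fock_norm alpha p f <= M%:E)%E ->
    modulus (f z) * gauss_weight (alpha / 2) z <= B.
Proof.
move=> al0; case: p => [q| |] //; last first.
  move=> _; exists `|M| => // f z fe fM; rewrite -lee_fin.
  apply: (@le_trans _ _ M%:E); last by rewrite lee_fin ler_norm.
  by apply: le_trans fM; apply: ereal_sup_ubound; exists z.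
rewrite lee_fin => q1; have q0 : 0 < q by lra.
pose c := alpha * q / (2 * pi); have c0 : 0 < c.
  by rewrite divr_gt0 ?mulr_gt0 ?pi_gt0.
(* The 1 provides the positivity and the strict inequality that [pointwise_density] demands. *)
pose S := M `^ q / c + 1.
have S0 : 0 < S by rewrite ltr_wpDl// divr_ge0 ?powR_ge0// ltW.
exists (4 * (4 + expR (4 * alpha * q)) * S `^ q^-1).
  by rewrite !mulr_ge0 ?addr_ge0 ?expR_ge0 ?powR_ge0.
move=> f z fe fM; apply: pointwise_density => //; first by rewrite powR_gt0.
have M0 : 0 <= M by rewrite -lee_fin (le_trans (fock_norm_ge0 _ _ _) fM).
rewrite -powRrM mulVf ?gt_eqF// powRr1 1?ltW//.
apply: (@le_lt_trans _ _ (M `^ q / c)%:E); last by rewrite lte_fin ltrDl.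
rewrite EFinM lee_pdivlMr// muleC.
move: fM; rewrite /fock_norm -/c.
set I := (\int[_]_w _)%E; rewrite -[X in (_ * X <= _)%E]/I => fM.
have I0 : (0 <= c%:E * I)%E.
  apply: mule_ge0; first by rewrite lee_fin ltW.
  rewrite /I; apply: integral_ge0 => w _.
  by rewrite lee_fin; exact: fock_density_ge0.
have := @gt0_ler_poweR R q (ltW q0) _ _ _ _ fM.
rewrite -poweRrM mulVf ?gt_eqF// poweRe1// poweR_EFin; apply.
- by rewrite in_itv /= poweR_ge0 leey.
- by rewrite in_itv /= lee_fin M0 leey.
Qed.

End FockNorm.

(** * Normal families *)

Section LocallyUniform.
Context {R : realType}.
Implicit Types (f : R[i] -> R[i]) (z : R[i]).

(** Compactness of the square [-r, r]^2 for an arbitrary filter. With the filter at +oo it bounds a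
    function on a disc; with an ultrafilter it makes convergence uniform on discs. *)
Lemma near_disc (I : Type) (F : set_system I) (P : I -> R[i] -> Prop) (r : R) :
  Filter F ->
  (forall z, exists2 d : R, 0 < d & F (fun i => forall w, modulus (w - z) <= d -> P i w)) ->
  F (fun i => forall z, modulus z <= r -> P i z).
Proof.
move=> FF loc; pose K : set (R * R) := `[- r, r] `*` `[- r, r].
have cK : compact K by apply: compact_setX; exact: segment_compact.
have /compact_near_coveringP cov := cK.
have : \near F, K `<=` (fun w => P F (w.1 +i* w.2)).
  apply: (cov I F (fun i w => P i (w.1 +i* w.2)) FF) => -[x y] _.
  have [d d0 Fd] := loc (x +i* y).
  exists (ball (x, y) (d / 2), (fun i => forall w, modulus (w - (x +i* y)) <= d -> P i w)).
    by split => //=; apply: nbhsx_ballx; rewrite divr_gt0.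
  move=> [[u v] i] /= [[uv1 uv2] H]; apply: H.
  rewrite (le_trans (modulus_le_ReIm _))// [leRHS]splitr.
  by rewrite complex_sub /=; apply: lerD; rewrite distrC ltW.
apply: filterS => i Ki [x y] zr; apply: (Ki (x, y)).
have := le_trans (le_Re_modulus (x +i* y)) zr.
have := le_trans (le_Im_modulus (x +i* y)) zr.
by rewrite !ler_norml /= => ? ?; split; rewrite /= in_itv.
Qed.

Lemma entire_bounded_disc f (r : R) : entire f ->
  exists2 M : R, 0 <= M & forall z, modulus z <= r -> modulus (f z) <= M.
Proof.
move=> fe.
have H : \forall M \near +oo, forall z, modulus z <= r -> modulus (f z) <= M.
  apply: near_disc => z; have [d d0 Hd] := entire_ccont z fe ltr01.
  exists (d / 2); first by rewrite divr_gt0.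
  near=> M => w wz.
  have := Hd (w - z); rewrite [z + _]addrC subrK => /(_ _) Hw.
  have {}Hw : modulus (f w - f z) <= 1 by apply: Hw; rewrite (le_lt_trans wz)//; lra.
  rewrite -[f w](subrK (f z)) (le_trans (le_modulusD _ _))//.
  have : 1 + modulus (f z) <= M by near: M; apply: nbhs_pinfty_ge; exact: num_real.
  lra.
have [M [MH M0]] : exists M, (forall z, modulus z <= r -> modulus (f z) <= M) /\ 0 <= M.
  near (pinfty_nbhs R) => M; exists M; split; first by near: M.
  by near: M; apply: nbhs_pinfty_ge; exact: num_real.
by exists M.
Unshelve. all: by end_near. Qed.

End LocallyUniform.

(** * Limits along ultrafilters and Montel's theorem *)

Section Ultralimit.
Context {R : realType} {U : set_system nat} {UU : UltraFilter U}.

(** The limit is the supremum of the thresholds that lie below [x n] for U-almost all n. By the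
    ultrafilter dichotomy the values stay below [sup S + e] U-almost always, as otherwise
    [sup S + e] would itself be a threshold. *)
Lemma ultralimit_real (x : nat -> R) (M : R) : (forall n, `|x n| <= M) ->
  exists l : R, forall e, 0 < e -> U (fun n => `|x n - l| <= e).
Proof.
move=> xM; pose S := [set t | U (fun n => t <= x n)].
have S1 : S (- M).
  by apply: filterS filterT => n _ /=; have := xM n; rewrite ler_norml => /andP[].
have SM : ubound S M.
  move=> t St; have [n tn] := filter_ex St.
  by rewrite (le_trans tn)// (le_trans (ler_norm _)).
have hS : has_sup S by split; [exists (- M)|exists M].
exists (sup S) => e e0; have [t St te] := sup_adherent e0 hS.
have [U1|U1] := in_ultra_setVsetC (fun n => sup S + e <= x n) UU.
  have : sup S + e <= sup S by apply: ub_le_sup => //; exists M.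
  lra.
have U2 : U (fun n => t <= x n) by [].
apply: filterS2 U1 U2 => n /= /negP; rewrite -ltNge => h1 h2.
by rewrite ler_norml; apply/andP; split; lra.
Qed.

Lemma ultralimit_complex (v : nat -> R[i]) (M : R) : (forall n, modulus (v n) <= M) ->
  exists l : R[i], forall e, 0 < e -> U (fun n => modulus (v n - l) <= e).
Proof.
move=> vM.
have [x Hx] := @ultralimit_real (fun n => Re (v n)) M
  (fun n => le_trans (le_Re_modulus _) (vM n)).
have [y Hy] := @ultralimit_real (fun n => Im (v n)) M
  (fun n => le_trans (le_Im_modulus _) (vM n)).
exists (x +i* y) => e e0; have e2 : 0 < e / 2 by rewrite divr_gt0.
apply: filterS2 (Hx _ e2) (Hy _ e2) => n h1 h2.
by rewrite (le_trans (modulus_le_ReIm _))// !raddfB /=; lra.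
Qed.

(** Members of U are nonempty, so a statement free of n that holds U-almost always simply holds.
    Inequalities pass to ultralimits in this way. *)
Lemma ultralimit_le (c : R) : (forall e : R, 0 < e -> U (fun=> c <= e)) -> c <= 0.
Proof.
by move=> H; apply/ler_addgt0Pr => e /H /filter_ex[n]; rewrite add0r.
Qed.

(* Normal families: along an ultrafilter the pointwise limit exists without
   extracting a subsequence. *)
Lemma montel (u : nat -> R[i] -> R[i]) (B : R -> R) :
  (forall n, entire (u n)) ->
  (forall n r z, modulus z <= r -> modulus (u n z) <= B r) ->
  exists g : R[i] -> R[i], [/\ entire g,
    (forall z e, 0 < e -> U (fun n => modulus (u n z - g z) <= e)) &
    (forall r e, 0 < e ->
       U (fun n => forall z, modulus z <= r -> modulus (u n z - g z) <= e))].
Proof.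
move=> ue uB.
have /choice[g gP] : forall z, exists l, forall e : R, 0 < e ->
    U (fun n => modulus (u n z - l) <= e).
  by move=> z; apply: (@ultralimit_complex _ (B (modulus z))) => n; exact: uB.
have uM n b z : modulus (z - b) <= 3 -> modulus (u n z) <= B (modulus b + 3).
  move=> zb; apply: uB; rewrite -[z](subrK b) addrC (le_trans (le_modulusD _ _))//.
  by rewrite lerD2l.
have ulip n a b : modulus (a - b) <= 1 / 2 ->
    modulus (u n a - u n b) <= 24 * B (modulus b + 3) * modulus (a - b).
  by move=> ab; apply: (entire_lipschitz (ue n)) => // z; exact: uM.
have glip a b : modulus (a - b) <= 1 / 2 ->
    modulus (g a - g b) <= 24 * B (modulus b + 3) * modulus (a - b).
  move=> ab; rewrite -subr_le0; apply: ultralimit_le => e e0.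
  have e2 : 0 < e / 2 by rewrite divr_gt0.
  apply: filterS2 (gP a _ e2) (gP b _ e2) => n h1 h2.
  have := ulip n _ _ ab.
  rewrite (_ : g a - g b = (u n a - u n b) - ((u n a - g a) - (u n b - g b))); last by ring.
  have := le_modulusB (u n a - u n b) ((u n a - g a) - (u n b - g b)).
  have := le_modulusB (u n a - g a) (u n b - g b).
  lra.
have B0 b : 0 <= B (modulus b + 3).
  by apply: le_trans (modulus_ge0 (u 0%N b)) _; apply: (@uM 0%N b b); rewrite subrr modulus0.
exists g; split => //.
- apply/entireP => b.
  (* The derivatives at b are bounded by the Cauchy estimate, so they too have an ultralimit l. The
     quadratic remainder bound, uniform in n, passes to the limit and makes l the derivative of
     g. *)
  have /choice[d dP] n : exists d, cdiff (u n) b d by move/entireP: (ue n).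
  have dM n : modulus (d n) <= 24 * B (modulus b + 3).
    by apply: (cdiff_bound (ue n)) (dP n) => z; exact: uM.
  have [l lP] := ultralimit_complex dM.
  have tay a : modulus (a - b) <= 1 / 2 ->
      modulus (g a - g b - l * (a - b)) <= 888 * B (modulus b + 3) * modulus (a - b) ^+ 2.
    move=> ab; rewrite -subr_le0; apply: ultralimit_le => e e0.
    have e3 : 0 < e / 3 by rewrite divr_gt0.
    apply: filterS2 (filterI (gP a _ e3) (gP b _ e3)) (lP _ e3) => n [h1 h2] h3.
    have := entire_taylor2 (ue n) (fun z => @uM n b z) ab (dP n) (dM n).
    rewrite (_ : g a - g b - l * (a - b) = (u n a - u n b - d n * (a - b)) -
       (((u n a - g a) - (u n b - g b)) - (d n - l) * (a - b))); last by ring.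
    have := le_modulusB (u n a - u n b - d n * (a - b))
      (((u n a - g a) - (u n b - g b)) - (d n - l) * (a - b)).
    have := le_modulusB ((u n a - g a) - (u n b - g b)) ((d n - l) * (a - b)).
    have := le_modulusB (u n a - g a) (u n b - g b).
    rewrite modulusM.
    have : modulus (d n - l) * modulus (a - b) <= e / 3 * 1.
      by apply: ler_pM; rewrite ?modulus_ge0//; lra.
    move: (888 * _ * _) => X; lra.
  move: tay (mulr_ge0 (ler0n R 888) (B0 b)); move: (888 * B _) => M tay M0.
  exists l => e e0.
  exists (Num.min (1 / 2) (e / (M + 1))).
    by rewrite lt_min !divr_gt0// ltr_wpDl.
  move=> h; rewrite lt_min => /andP[h1 h2].
  have := tay (b + h); rewrite addrAC subrr add0r => /(_ (ltW h1)).
  move=> /le_trans; apply.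
  rewrite expr2 mulrA ler_wpM2r ?modulus_ge0//.
  apply: (@le_trans _ _ ((M + 1) * modulus h)).
    by rewrite ler_wpM2r ?modulus_ge0// lerDl.
  by rewrite mulrC -ler_pdivlMr ?ltr_wpDl// ltW.
(* The common Lipschitz constant spreads the convergence at z over a small disc around it. *)
- move=> r e e0; apply: near_disc => z.
  have e3 : 0 < e / 3 by rewrite divr_gt0.
  move: (mulr_ge0 (ler0n R 24) (B0 z)) (fun n a => @ulip n a z) (fun a => @glip a z).
  move: (24 * B _) => M M0 {}ulip {}glip.
  exists (Num.min (1 / 2) (e / 3 / (M + 1))).
    by rewrite lt_min !divr_gt0// ltr_wpDl.
  apply: filterS (gP z _ e3) => n h1 w; rewrite le_min => /andP[w1 w2].
  have Mw : M * modulus (w - z) <= e / 3.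
    apply: (@le_trans _ _ ((M + 1) * modulus (w - z))).
      by rewrite ler_wpM2r ?modulus_ge0// lerDl.
    by rewrite mulrC -ler_pdivlMr ?ltr_wpDl.
  have h2 := le_trans (ulip n _ w1) Mw; have h3 := le_trans (glip _ w1) Mw.
  rewrite (_ : u n w - g w = ((u n w - u n z) + (u n z - g z)) - (g w - g z)); last by ring.
  have := le_modulusB ((u n w - u n z) + (u n z - g z)) (g w - g z).
  have := le_modulusD (u n w - u n z) (u n z - g z).
  lra.
Qed.

End Ultralimit.

(** U contains every tail, so each of its members meets every tail. Hence indices with ever smaller
    values of [x] can be chosen in increasing order. *)
Lemma extract_subsequence (R : realType) (U : set_system nat) 
    (x : nat -> \bar R) :
  ProperFilter U -> \oo `<=` U -> (forall n, (0 <= x n)%E) ->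
  (forall e : R, 0 < e -> U (fun n => (x n <= e%:E)%E)) ->
  exists2 s : nat -> nat, increasing_seq s & x (s n) @[n --> \oo] --> 0%E.
Proof.
move=> UF Uoo x0 xU.
have /choice[f fP] : forall nN : nat * nat, exists m,
    (nN.2 < m)%N /\ (x m <= (nN.1.+1%:R^-1)%:E)%E.
  move=> [n N].
  have U1 : U (fun m => (N < m)%N) by apply: Uoo; exists N.+1.
  have U2 := xU n.+1%:R^-1; rewrite invr_gt0 ltr0n in U2.
  by have [m] := filter_ex (filterI U1 (U2 isT)); exists m.
pose s := fix s n := if n is m.+1 then f (m.+1, s m) else f (0%N, 0%N).
have sx n : (x (s n) <= (n.+1%:R^-1)%:E)%E by case: n => [|n]; exact: (fP (_, _)).2.
exists s; first by apply/increasing_seqP => n; exact: (fP (n.+1, s n)).1.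
apply: (@squeeze_cvge _ _ _ _ (fun=> 0%E) _ (fun n => (n.+1%:R^-1)%:E)).
- by apply: nearW => n; rewrite x0 sx.
- exact: cvg_cst.
- by apply: cvg_EFin; [exact: nearW|exact: cvg_harmonic].
Qed.

(** * Order, type and growth *)

Section Growth.
Context {R : realType}.
Implicit Types (f psi : R[i] -> R[i]) (z : R[i]).

Lemma modulus_on_circle (r : R) : 0 <= r -> exists z : R[i], modulus z = r.
Proof. by move=> r0; exists r%:C; rewrite modulus_real ger0_norm. Qed.

Lemma modulus_le_max_modulus f z : entire f -> modulus (f z) <= max_modulus f (modulus z).
Proof.
move=> fe; apply: ub_le_sup; last by exists z.
have [M _ MP] := entire_bounded_disc (modulus z) fe.
by exists M => _ [w /= wz <-]; apply: MP; rewrite wz.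
Qed.

Lemma max_modulus_le f (r M : R) : 0 <= r ->
  (forall z, modulus z = r -> modulus (f z) <= M) -> max_modulus f r <= M.
Proof.
move=> r0 H; have [z zr] := modulus_on_circle r0.
apply: ge_sup; first by exists (modulus (f z)), z.
by move=> _ [w /= wr <-]; exact: H.
Qed.

Lemma limf_esup_pinfty_lt (g : R -> R) (l : R) :
  (limf_esup (fun r => (g r)%:E) (pinfty_nbhs R) < l%:E)%E ->
  exists2 k : R, k < l & exists M : R, forall r, M < r -> g r <= k.
Proof.
move=> /ereal_inf_lt[_ [V [M [_ MV]] <-]] Vl.
set S := ereal_sup _ in Vl.
have SV r : M < r -> ((g r)%:E <= S)%E.
  by move=> Mr; apply: ereal_sup_ubound; exists r => //; exact: MV.
case: S SV Vl => [k| |] SV Vl //.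
- by exists k; [rewrite -lte_fin|exists M => r /SV; rewrite lee_fin].
- by have := SV (M + 1); rewrite ltrDl ltr01 => /(_ isT).
Qed.

Lemma limf_esup_pinfty_le (g : R -> R) (l : R) :
  (forall e, 0 < e -> exists M : R, forall r, M < r -> g r <= l + e) ->
  (limf_esup (fun r => (g r)%:E) (pinfty_nbhs R) <= l%:E)%E.
Proof.
move=> H; apply/lee_addgt0Pr => e e0; have [M MP] := H e e0.
apply: (@le_trans _ _ (ereal_sup ((fun r => (g r)%:E) @` [set r | M < r]))).
  apply: ereal_inf_lbound; exists [set r | M < r] => //.
  by exists M; split => //; exact: num_real.
by apply: ge_ereal_sup => _ [r Mr <-]; rewrite -EFinD lee_fin MP.
Qed.

Lemma le_expR_of_ln (x y : R) : ln x <= y -> 0 < x -> x <= expR y.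
Proof. by move=> xy x0; rewrite -[x]lnK ?posrE// ler_expR. Qed.

(** Both alternatives lead to one Gaussian bound with room below k: an order rho < 2 gives
    exp(r^rho) <= exp(k r^2 / 2) for large r, and a type below k gives some t < k directly. The
    constant [C] takes care of the remaining disc. *)
Lemma growth_of_order psi (k : R) : entire psi -> 0 < k ->
  ((entire_order psi < 2%:E)%E \/
   (entire_order psi = 2%:E /\ (entire_type psi < k%:E)%E)) ->
  exists2 t : R, t < k & exists2 C : R, 0 <= C &
    forall z, modulus (psi z) <= C * expR (t * modulus z ^+ 2).
Proof.
move=> pe k0 ord.
have [t tk [r0 H]] : exists2 t : R, t < k & exists r0 : R, forall r, r0 < r ->
    max_modulus psi r <= expR (t * r ^+ 2).
  case: ord => [|[ord2]].
    move=> /limf_esup_pinfty_lt[rho rho2 [M MP]].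
    exists (k / 2); first by lra.
    have k20 : 0 < k / 2 by rewrite divr_gt0.
    (* The last radius is where r^rho = (k / 2) r^2. *)
    exists (Num.max (Num.max M 1) (expR (- ln (k / 2) / (2 - rho)))) => r.
    rewrite !gt_max => /andP[/andP[Mr r1] rr].
    have r0 : 0 < r by lra.
    have lr0 : 0 < ln r by rewrite ln_gt0.
    (* If the maximum modulus is at most 1, the iterated logarithm takes its default value 0 and
       carries no information, but the bound is trivial. *)
    have [m1|m1] := leP (max_modulus psi r) 1.
      rewrite (le_trans m1)// -[leLHS]expR0 ler_expR.
      by apply: mulr_ge0; [exact: ltW|exact: sqr_ge0].
    apply: le_expR_of_ln; last by lra.
    have l0 : 0 < ln (max_modulus psi r) by rewrite ln_gt0.
    have := MP r Mr; rewrite ler_pdivrMr// => /le_expR_of_ln/(_ l0)/le_trans; apply.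
    have -> : k / 2 * r ^+ 2 = expR (ln (k / 2) + 2 * ln r).
      by rewrite expRD lnK ?posrE// (expRM_natl 2) lnK ?posrE.
    rewrite ler_expR; have : - ln (k / 2) / (2 - rho) <= ln r.
      by rewrite -ler_expR lnK ?posrE// ltW.
    rewrite ler_pdivrMr; lra.
  rewrite /entire_type ord2 => /limf_esup_pinfty_lt[t tk [M MP]].
  exists t => //; exists (Num.max M 1) => r; rewrite gt_max => /andP[Mr r1].
  have r0 : 0 < r by lra.
  have [m0|m0] := leP (max_modulus psi r) 0.
    by rewrite (le_trans m0)// expR_ge0.
  apply: le_expR_of_ln => //.
  have := MP r Mr; rewrite /= powR_mulrn ?(ltW r0)// ler_pdivrMr//.
  by rewrite exprn_gt0.
have [C0 C00 C0P] := entire_bounded_disc r0 pe.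
(* The 1 serves outside the disc of radius r0. Inside, t may be negative, and exp(|t| r0^2) makes up
   for the factor exp(t |z|^2). *)
exists t => //; exists (1 + C0 * expR (`|t| * r0 ^+ 2)).
  by rewrite addr_ge0// mulr_ge0// expR_ge0.
move=> z; have [zr|zr] := leP (modulus z) r0; last first.
  rewrite (le_trans (modulus_le_max_modulus z pe))// (le_trans (H _ zr))//.
  by rewrite ler_peMl ?expR_ge0// lerDl mulr_ge0// expR_ge0.
rewrite (le_trans (C0P z zr))// mulrDl mul1r -mulrA -expRD.
apply: (@le_trans _ _ (C0 * expR (`|t| * r0 ^+ 2 + t * modulus z ^+ 2))); last first.
  by rewrite lerDr expR_ge0.
rewrite ler_peMr// -expR0 ler_expR.
have m0 := modulus_ge0 z.
have : `|t| * modulus z ^+ 2 <= `|t| * r0 ^+ 2.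
  by rewrite ler_wpM2l// ler_sqr ?nnegrE//; lra.
have : - (t * modulus z ^+ 2) <= `|t| * modulus z ^+ 2.
  by rewrite -mulNr ler_wpM2r ?sqr_ge0// -normrN ler_norm.
lra.
Qed.

(** The constant and the linear term disappear on division by r^2. The type is compared with k only
    for order 2, since it is measured against r to the power of the order. *)
Lemma order_of_growth psi (C k B : R) : entire psi -> 0 < k -> 0 <= B -> 1 <= C ->
  (forall z, modulus (psi z) <= C * expR (k * modulus z ^+ 2 + B * modulus z)) ->
  (entire_order psi <= 2%:E)%E /\
  (entire_order psi = 2%:E -> (entire_type psi <= k%:E)%E).
Proof.
move=> pe k0 B0 C1 H.
have lnC0 : 0 <= ln C by rewrite ln_ge0.
have lnmax r : 1 < r -> ln (max_modulus psi r) <= ln C + (k * r ^+ 2 + B * r).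
  move=> r1; have r0 : 0 <= r by lra.
  (* ln vanishes on nonpositive reals *)
  have [m0|m0] := leP (max_modulus psi r) 0.
    by rewrite ln0// !addr_ge0// mulr_ge0 ?sqr_ge0// ltW.
  have C0 : 0 < C by lra.
  rewrite -[X in _ + X]expRK -lnM ?posrE ?expR_gt0// ler_ln ?posrE ?mulr_gt0 ?expR_gt0//.
  by apply: max_modulus_le => // z zr; rewrite -zr.
split.
  apply: limf_esup_pinfty_le => e e0.
  (* For r > 1 all terms of the exponent are at most their coefficients times r^2; beyond exp(ln K /
     e) the contribution ln K is at most e ln r. *)
  pose K := ln C + k + B; have K0 : 0 < K by rewrite /K; lra.
  exists (Num.max 1 (expR (ln K / e))) => r; rewrite gt_max => /andP[r1 rr].
  have r0 : 0 < r by lra.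
  have lr0 : 0 < ln r by rewrite ln_gt0.
  rewrite ler_pdivrMr//.
  have [l0|l0] := leP (ln (max_modulus psi r)) 0.
    by rewrite ln0// mulr_ge0// ?addr_ge0// ltW.
  have lK : ln (max_modulus psi r) <= K * r ^+ 2.
    rewrite (le_trans (lnmax r r1))// /K.
    have : ln C <= ln C * r ^+ 2 by rewrite ler_peMr// exprn_ege1// ltW.
    have : B * r <= B * r ^+ 2 by rewrite ler_wpM2l// expr2 ler_peMl; lra.
    lra.
  have {}lK : ln (ln (max_modulus psi r)) <= ln K + 2 * ln r.
    apply: (@le_trans _ _ (ln (K * r ^+ 2))).
      by rewrite ler_ln ?posrE// mulr_gt0// exprn_gt0.
    rewrite lnM ?posrE ?exprn_gt0// -[in leLHS](lnK (x := r)) ?posrE//.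
    by rewrite -expRM_natl expRK.
  have : ln K / e <= ln r by rewrite -ler_expR lnK ?posrE// ltW.
  rewrite ler_pdivrMr//; lra.
move=> o2; rewrite /entire_type o2; apply: limf_esup_pinfty_le => e e0.
exists (Num.max 1 ((B + ln C) / e)) => r; rewrite gt_max => /andP[r1 rr].
have r0 : 0 < r by lra.
rewrite /= powR_mulrn ?(ltW r0)// ler_pdivrMr ?exprn_gt0//.
rewrite (le_trans (lnmax r r1))//.
move: rr; rewrite ltr_pdivrMr// => rr.
have : ln C <= ln C * r by rewrite ler_peMr// ltW.
have : (B + ln C) * r <= (r * e) * r by rewrite ler_wpM2r// ltW.
by rewrite expr2; lra.
Qed.

End Growth.

(** * Weighted composition operators *)

Section WeightedComposition.
Context {R : realType}.
Variables (alpha : R) (a lambda : R[i]) (psi : R[i] -> R[i]).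
Hypotheses (alpha_gt0 : 0 < alpha) (psi_entire : entire psi).
Implicit Types (f h : R[i] -> R[i]) (z w : R[i]).

Let phi := fun z : R[i] => (a + lambda * z : R[i]).
Let beta : R := 1 - modulus lambda ^+ 2.
Let W := weighted_comp psi phi.
Local Notation gw := (gauss_weight (alpha / 2)).

Lemma entire_weighted_comp f : entire f -> entire (W f).
Proof.
by move=> fe; exact: (entireM psi_entire (entire_comp fe (@entire_affine R a lambda))).
Qed.

Lemma gauss_weight_small (d c e : R) : 0 < d -> 0 <= c -> 0 < e ->
  exists2 r : R, 0 < r & forall z, r <= modulus z -> c * gauss_weight d z < e.
Proof.
move=> d0 c0 e0; have q0 : 0 <= c / (d * e) by rewrite divr_ge0// ltW// mulr_gt0.
exists (1 + c / (d * e)); first lra.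
move=> z rz; rewrite /gauss_weight mulNr expRN ltr_pdivrMr ?expR_gt0//.
have t1 : 1 <= modulus z by lra.
apply: (@lt_le_trans _ _ (e * (1 + d * modulus z ^+ 2))); last first.
  by rewrite ler_pM2l// expR_ge1Dx.
have : c / (d * e) <= modulus z ^+ 2 by rewrite expr2; nra.
rewrite ler_pdivrMr ?mulr_gt0//; lra.
Qed.

(** The total exponent is at most -k |z|^2 + s |z| plus a constant, where k is the gap; half of k
    absorbs the linear term. The remaining rate k / 2 is written 2 d because it is split later, one
    d for smallness at infinity and one d for the finiteness of the norm. *)
Lemma weighted_comp_decay (t C : R) : t < alpha * beta / 2 -> 0 <= C ->
  (forall z, modulus (psi z) <= C * expR (t * modulus z ^+ 2)) ->
  exists2 d : R, 0 < d & exists2 D : R, 0 <= D &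
  forall h (B : R), (forall z, modulus (h z) * gw z <= B) ->
  forall z, modulus (W h z) * gw z <= D * B * gauss_weight (2 * d) z.
Proof.
move=> tb C0 psiC; pose k := alpha * beta / 2 - t.
have k0 : 0 < k by rewrite subr_gt0.
pose s := alpha * modulus a * modulus lambda.
(* The second term comes from s |z| <= (k / 2) |z|^2 + s^2 / (2 k). *)
pose c0 := alpha / 2 * modulus a ^+ 2 + s ^+ 2 / (2 * k).
exists (k / 4); first by rewrite divr_gt0.
exists (C * expR c0); first by rewrite mulr_ge0 ?expR_ge0.
move=> h B hB z.
have B0 : 0 <= B by rewrite (le_trans _ (hB 0))// mulr_ge0 ?modulus_ge0 ?gauss_weight_ge0.
have hphi : modulus (h (phi z)) <= B * expR (alpha / 2 * modulus (phi z) ^+ 2).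
  have := hB (phi z); rewrite /gauss_weight mulNr expRN.
  by rewrite ler_pdivrMr ?expR_gt0.
rewrite /W /weighted_comp modulusM.
apply: (@le_trans _ _ ((C * expR (t * modulus z ^+ 2)) *
   (B * expR (alpha / 2 * modulus (phi z) ^+ 2)) * gw z)).
  apply: ler_wpM2r; first exact: gauss_weight_ge0.
  by apply: ler_pM; rewrite ?modulus_ge0.
rewrite (_ : _ * _ * _ = C * B * (expR (t * modulus z ^+ 2) *
   expR (alpha / 2 * modulus (phi z) ^+ 2) * gw z)); last by ring.
rewrite (_ : C * expR c0 * B * _ = C * B * (expR c0 * gauss_weight (2 * (k / 4)) z)); last by ring.
apply: ler_wpM2l; first exact: mulr_ge0.
rewrite /gauss_weight -!expRD ler_expR.
have mz := modulus_ge0 z; have ma := modulus_ge0 a; have ml := modulus_ge0 lambda.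
have mp : modulus (phi z) ^+ 2 <= (modulus a + modulus lambda * modulus z) ^+ 2.
  rewrite ler_sqr ?nnegrE ?modulus_ge0 ?addr_ge0 ?mulr_ge0//.
  by rewrite (le_trans (le_modulusD _ _))// modulusM.
have {}mp : alpha / 2 * modulus (phi z) ^+ 2 <=
    alpha / 2 * (modulus a + modulus lambda * modulus z) ^+ 2.
  by apply: ler_wpM2l => //; rewrite divr_ge0// ltW.
have sq : s * modulus z <= k / 2 * modulus z ^+ 2 + s ^+ 2 / (2 * k).
  rewrite -subr_ge0 (_ : _ - _ = (k * modulus z - s) ^+ 2 / (2 * k)); last first.
    by field; rewrite gt_eqF.
  by rewrite divr_ge0 ?sqr_ge0// mulr_ge0// ltW.
have E : t * modulus z ^+ 2 + alpha / 2 * (modulus a + modulus lambda * modulus z) ^+ 2 -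
    alpha / 2 * modulus z ^+ 2 =
    - k * modulus z ^+ 2 + s * modulus z + alpha / 2 * modulus a ^+ 2.
  by rewrite /k /s /beta; field.
rewrite /c0; lra.
Qed.

(** * Compactness from Gaussian decay *)

Section decay.
Variables (d D : R).
Hypotheses (d_gt0 : 0 < d) (D_ge0 : 0 <= D).
Hypothesis decay : forall h (B : R), (forall z, modulus (h z) * gw z <= B) ->
  forall z, modulus (W h z) * gw z <= D * B * gauss_weight (2 * d) z.

Let bound_ge0 h (B : R) : (forall z, modulus (h z) * gw z <= B) -> 0 <= B.
Proof.
by move=> /(_ 0); apply: le_trans; rewrite mulr_ge0 ?modulus_ge0 ?gauss_weight_ge0.
Qed.

Lemma fock_weighted_comp (p : \bar R) h (B : R) : (1%:E <= p)%E -> entire h ->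
  (forall z, modulus (h z) * gw z <= B) -> fock alpha p (W h).
Proof.
move=> p1 he hB; split; first exact: entire_weighted_comp.
have d20 : 0 < 2 * d by rewrite mulr_gt0.
have [K K0 HK] := fock_norm_le_gauss alpha_gt0 p1 d20.
have DB : 0 <= D * B by rewrite mulr_ge0// (bound_ge0 hB).
apply: le_lt_trans (HK _ 0 (D * B) (entire_weighted_comp he) DB _) (ltry _).
by move=> z; rewrite subr0; exact: decay.
Qed.

Lemma fock0_weighted_comp h (B : R) : entire h ->
  (forall z, modulus (h z) * gw z <= B) -> fock0 alpha (W h).
Proof.
move=> he hB; split; first exact: (fock_weighted_comp (leey _) he hB).
move=> e e0; have d20 : 0 < 2 * d by rewrite mulr_gt0.
have DB : 0 <= D * B by rewrite mulr_ge0// (bound_ge0 hB).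
have [r _ Hr] := gauss_weight_small d20 DB e0.
by exists r => z /Hr; exact/le_lt_trans/decay.
Qed.

Lemma weighted_comp_linear f g (c : R[i]) :
  W (fun z => c * f z + g z) = (fun z => c * W f z + W g z).
Proof. by apply/funext => z; rewrite /W /weighted_comp; ring. Qed.

(** The hypothesis is a weighted sup bound, which every norm in question implies, so one statement
    serves all spaces. Outside a large disc the decay controls the difference; inside it the
    ultralimit is uniform. A subsequence is extracted only at the end, from the numerical sequence
    of norms. *)
Lemma weighted_comp_subsequence (p : \bar R) (u : nat -> R[i] -> R[i]) (B : R) :
  (1%:E <= p)%E -> (forall n, entire (u n)) ->
  (forall n z, modulus (u n z) * gw z <= B) ->
  exists (s : nat -> nat) (g : R[i] -> R[i]), [/\ increasing_seq s, entire g,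
    (forall z, modulus (g z) * gw z <= B) &
    fock_norm alpha p (fun z => W (u (s n)) z - W g z) @[n --> \oo] --> 0%E].
Proof.
move=> p1 ue uB.
have B0 : 0 <= B := bound_ge0 (uB 0%N).
have [U [UU Uoo]] := ultraFilterLemma (eventually_filter).
have uBr n r z : modulus z <= r -> modulus (u n z) <= B * expR (alpha / 2 * r ^+ 2).
  move=> zr; have := uB n z; rewrite /gauss_weight mulNr expRN.
  rewrite ler_pdivrMr ?expR_gt0// => /le_trans; apply.
  apply: ler_wpM2l => //; rewrite ler_expR.
  apply: ler_wpM2l; first by rewrite divr_ge0// ltW.
  by rewrite ler_sqr ?nnegrE ?(le_trans (modulus_ge0 z) zr) ?modulus_ge0.
have [g [ge gU gUr]] := montel ue uBr.
have gB z : modulus (g z) * gw z <= B.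
  rewrite -subr_le0; apply: ultralimit_le => e e0.
  apply: filterS (gU z _ e0) => n une.
  have := ler_modulus_sub (g z) (u n z); rewrite modulusB => gu.
  have a20 : 0 <= alpha / 2 by rewrite divr_ge0// ltW.
  have w1 := gauss_weight_le1 z a20; have w0 := gauss_weight_gt0 (alpha / 2) z.
  have ub := uB n z.
  have : (modulus (g z) - modulus (u n z)) * gw z <= e * gw z.
    by apply: ler_wpM2r; [exact: ltW|lra].
  have : e * gw z <= e by rewrite ler_piMr// ltW.
  lra.
have [K K0 HK] := fock_norm_le_gauss alpha_gt0 p1 d_gt0.
pose v n z : R[i] := u n z + (-1) * g z.
have ve n : entire (v n) by exact: (entireD (ue n) (@entire_scale _ _ (-1) ge)).
have vE n z : v n z = u n z - g z by rewrite /v mulN1r.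
have vB n z : modulus (v n z) * gw z <= B + B.
  rewrite vE; apply: (@le_trans _ _ ((modulus (u n z) + modulus (g z)) * gw z)).
    by apply: ler_wpM2r; [exact: gauss_weight_ge0|exact: le_modulusB].
  by rewrite mulrDl lerD.
have WE n : (fun z => W (u n) z - W g z) = W (v n).
  by apply/funext => z; rewrite /W /weighted_comp vE mulrBr.
have small (e : R) : 0 < e ->
    U (fun n => (fock_norm alpha p (fun z => W (u n) z - W g z)%R <= (K * e)%:E)%E).
  move=> e0.
  have D2B : 0 <= D * (B + B) by rewrite mulr_ge0// addr_ge0.
  have [r r0 Hr] := gauss_weight_small d_gt0 D2B e0.
  have [M M0 HM] := entire_bounded_disc r psi_entire.
  (* Chosen so that (M + 1) eta is the least value of e exp(-d |z|^2) on the disc |z| <= r. The disc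
     on which the convergence is used next contains the image of this one under [phi]. *)
  pose eta := e * expR (- d * r ^+ 2) / (M + 1).
  have M1 : 0 < M + 1 by lra.
  have eta0 : 0 < eta by rewrite divr_gt0// mulr_gt0// expR_gt0.
  apply: filterS (gUr (modulus a + modulus lambda * r) _ eta0) => n Hn.
  rewrite WE; apply: (HK _ 0 e (entire_weighted_comp (ve n)) (ltW e0)) => z.
  rewrite subr0.
  have [zr|zr] := leP (modulus z) r; last first.
    rewrite (le_trans (decay (vB n) z))//.
    (* One factor pushes D (B + B) below e outside the disc of radius r; the other remains as the
       Gaussian for [fock_norm_le_gauss]. *)
    rewrite (_ : gauss_weight (2 * d) z = gauss_weight d z * gauss_weight d z); last first.
      by rewrite /gauss_weight -expRD; congr expR; ring.
    by rewrite mulrA ler_wpM2r ?gauss_weight_ge0// ltW// Hr// ltW.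
  apply: (@le_trans _ _ (modulus (W (v n) z))).
    by rewrite ler_piMr ?modulus_ge0// gauss_weight_le1// divr_ge0// ltW.
  rewrite /W /weighted_comp modulusM.
  apply: (@le_trans _ _ ((M + 1) * eta)).
    apply: ler_pM; rewrite ?modulus_ge0//.
      by rewrite (le_trans (HM _ zr))// lerDl.
    rewrite vE; apply: Hn; rewrite (le_trans (le_modulusD _ _))// modulusM.
    by rewrite lerD2l ler_wpM2l ?modulus_ge0.
  rewrite /eta mulrC divfK ?gt_eqF// /gauss_weight ler_pM2l// ler_expR !mulNr lerN2.
  apply: ler_wpM2l; first exact: ltW.
  by rewrite ler_sqr ?nnegrE ?modulus_ge0// ltW.
have K1 : 0 < K + 1 by lra.
have [s s_inc s_cvg] : exists2 s : nat -> nat, increasing_seq s &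
    fock_norm alpha p (fun z => W (u (s n)) z - W g z) @[n --> \oo] --> 0%E.
  apply: (extract_subsequence (x := fun n => fock_norm alpha p (fun z => W (u n) z - W g z)) _ Uoo).
    by move=> n; exact: fock_norm_ge0.
  move=> e e0; have := small _ (divr_gt0 e0 K1); apply: filterS => n /le_trans; apply.
  by rewrite lee_fin mulrA ler_pdivrMr// mulrC ler_pM2l// lerDl.
by exists s, g.
Qed.

Lemma compact_weighted_comp (p : \bar R) : (1%:E <= p)%E ->
  compact_operator (fock alpha p) (fock_norm alpha p) W.
Proof.
move=> p1; split.
  split; last by move=> *; exact: weighted_comp_linear.
  move=> f [fe ffin]; have f0 := fock_norm_ge0 alpha p f.
  have [B _ HB] := fock_norm_pointwise (fine (fock_norm alpha p f)) alpha_gt0 p1.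
  apply: (fock_weighted_comp p1 fe) => z; apply: HB => //.
  by rewrite fineK// ge0_fin_numE.
move=> u M uM.
have [B _ HB] := fock_norm_pointwise M alpha_gt0 p1.
have [|n z|s [g [s_inc ge gB cvg]]] := @weighted_comp_subsequence p u B p1.
- by move=> n; exact: (uM n).1.1.
- exact: (HB _ _ (uM n).1.1 (uM n).2).
- by exists s, (W g); exact: (And3 s_inc (fock_weighted_comp p1 ge gB) cvg).
Qed.

(** The locally uniform limit g of functions in [fock0] need not vanish at infinity after weighting;
    its image W g does, by the decay, and only W g has to lie in the space. *)
Lemma compact0_weighted_comp :
  compact_operator (fock0 alpha) (fock_norm alpha +oo%E) W.
Proof.
split.
  split; last by move=> *; exact: weighted_comp_linear.
  move=> f [[fe ffin] _]; have f0 := fock_norm_ge0 alpha +oo%E f.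
  have [B _ HB] := fock_norm_pointwise (fine (fock_norm alpha +oo%E f)) alpha_gt0 (leey _).
  apply: (fock0_weighted_comp fe) => z; apply: HB => //.
  by rewrite fineK// ge0_fin_numE.
move=> u M uM.
have [B _ HB] := fock_norm_pointwise M alpha_gt0 (leey 1%:E).
have [|n z|s [g [s_inc ge gB cvg]]] := @weighted_comp_subsequence +oo%E u B (leey _).
- by move=> n; exact: (uM n).1.1.1.
- exact: (HB _ _ (uM n).1.1.1 (uM n).2).
- by exists s, (W g); exact: (And3 s_inc (fock0_weighted_comp ge gB) cvg).
Qed.

End decay.

(** * Coherent states and the failure of boundedness *)

Definition coherent w z : R[i] :=
  cexp ((- (alpha / 2 * modulus w ^+ 2))%:C + (alpha%:C * (Re w +i* - Im w)) * z).

Lemma entire_coherent w : entire (coherent w).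
Proof.
exact: (entire_comp entire_cexp (@entire_affine R
  (- (alpha / 2 * modulus w ^+ 2))%:C (alpha%:C * (Re w +i* - Im w)))).
Qed.

(** By completing the square the weighted modulus is a translated Gaussian: its norms are controlled
    independently of w, and its value at w is 1. *)
Lemma modulus_coherent w z : modulus (coherent w z) * gw z = gw (z - w).
Proof.
rewrite modulus_cexp /gauss_weight -expRD; congr expR.
by rewrite !sqr_modulus; case: z w => [x y] [x' y'] /=; field.
Qed.

Lemma fock0_coherent w : fock0 alpha (coherent w).
Proof.
have a20 : 0 < alpha / 2 by rewrite divr_gt0.
have lew z : modulus (coherent w z) * gw z <= 1 * gw (z - w).
  by rewrite mul1r modulus_coherent.
split.
  split; first exact: entire_coherent.
  have [K _ HK] := fock_norm_le_gauss alpha_gt0 (leey 1%:E) a20.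
  have := HK _ w 1 (@entire_coherent w) ler01 lew.
  by move=> /le_lt_trans; apply; exact: ltry.
move=> e e0; have [r r0 Hr] := gauss_weight_small a20 ler01 e0.
exists (r + modulus w) => z zr; apply: le_lt_trans (lew z) (Hr _ _).
by have := ler_modulus_sub z w; lra.
Qed.

(** The operator is tested on the kernels alone, so [X] is left abstract: any space of entire
    functions containing them will do, which covers [fock] and [fock0] together. *)
Lemma growth_of_bounded (p : \bar R) (X : set (R[i] -> R[i])) : (1%:E <= p)%E ->
  X `<=` [set f | entire f] -> (forall w, X (coherent w)) ->
  bounded_operator X (fock_norm alpha p) W ->
  exists2 B : R, 0 <= B & forall z,
    modulus (psi z) <= B * expR (alpha / 2 * modulus z ^+ 2 - alpha / 2 * modulus (phi z) ^+ 2).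
Proof.
move=> p1 Xe Xk [[XW _] [M HM]].
have a20 : 0 < alpha / 2 by rewrite divr_gt0.
have [K K0 HK] := fock_norm_le_gauss alpha_gt0 p1 a20.
have [B B0 HB] := fock_norm_pointwise (`|M| * K) alpha_gt0 p1.
exists B => // z; set w := phi z.
have kK : (fock_norm alpha p (coherent w) <= K%:E)%E.
  rewrite -[K]mulr1; apply: (HK _ w 1 (@entire_coherent w) ler01) => v.
  by rewrite mul1r modulus_coherent.
have := HB (W (coherent w)) z (Xe _ (XW _ (Xk w))).
have -> : (fock_norm alpha p (W (coherent w)) <= (`|M| * K)%:E)%E.
  apply: le_trans (HM _ (Xk w)) _; rewrite EFinM.
  apply: (@le_trans _ _ (`|M|%:E * fock_norm alpha p (coherent w))%E).
    by apply: lee_wpmul2r; [exact: fock_norm_ge0|rewrite lee_fin ler_norm].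
  by apply: lee_wpmul2l => //; rewrite lee_fin.
move=> /(_ isT); rewrite /W /weighted_comp modulusM -/w.
have := modulus_coherent w w; rewrite subrr.
rewrite [gw 0]/gauss_weight modulus0 expr0n mulr0 expR0 => /(canRL (mulfK _)) ->; last first.
  by rewrite gt_eqF// gauss_weight_gt0.
rewrite mul1r /gauss_weight !mulNr !expRN invrK expRB => H.
rewrite mulrA ler_pdivlMr ?expR_gt0// -ler_pdivrMr ?expR_gt0//.
Qed.

Lemma growth_exponent z :
  alpha / 2 * modulus z ^+ 2 - alpha / 2 * modulus (phi z) ^+ 2 <=
  alpha * beta / 2 * modulus z ^+ 2 + alpha * modulus a * modulus lambda * modulus z.
Proof.
have mz := modulus_ge0 z; have ma := modulus_ge0 a; have ml := modulus_ge0 lambda.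
have mp := modulus_ge0 (phi z).
have h : modulus lambda * modulus z <= modulus (phi z) + modulus a.
  rewrite -modulusM (_ : lambda * z = phi z - a) ?le_modulusB//.
  by rewrite /phi addrAC subrr add0r.
have h2 : (modulus lambda * modulus z) ^+ 2 - 2 * modulus a * (modulus lambda * modulus z) <=
    modulus (phi z) ^+ 2.
  have y0 : 0 <= modulus lambda * modulus z by rewrite mulr_ge0.
  move: (modulus (phi z)) (modulus lambda * modulus z) (modulus a) mp ma h y0.
  (* For y <= b the left side y (y - 2 b) is nonpositive. Otherwise y - b is positive and the
     inequality x >= y - b may be squared. *)
  move=> x y b x0 b0 yxb y0; have [yb|yb] := leP y b; first by nra.
  have : 0 <= (x - (y - b)) * (x + (y - b)) by apply: mulr_ge0; lra.
  nra.
have : alpha / 2 * ((modulus lambda * modulus z) ^+ 2 -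
    2 * modulus a * (modulus lambda * modulus z)) <= alpha / 2 * modulus (phi z) ^+ 2.
  by apply: ler_wpM2l => //; rewrite divr_ge0// ltW.
rewrite /beta exprMn; lra.
Qed.

Lemma not_bounded (p : \bar R) (X : set (R[i] -> R[i])) : (1%:E <= p)%E ->
  modulus lambda < 1 ->
  X `<=` [set f | entire f] -> (forall w, X (coherent w)) ->
  ((2%:E < entire_order psi)%E \/
   (entire_order psi = 2%:E /\ ((alpha * beta / 2)%:E < entire_type psi)%E)) ->
  ~ bounded_operator X (fock_norm alpha p) W.
Proof.
move=> p1 l1 Xe Xk ord /(growth_of_bounded p1 Xe Xk)[B B0 HB].
have ml := modulus_ge0 lambda.
have k0 : 0 < alpha * beta / 2.
  rewrite divr_gt0// mulr_gt0// /beta subr_gt0 expr2.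
  by rewrite mulr_ilt1.
have s0 : 0 <= alpha * modulus a * modulus lambda.
  by rewrite !mulr_ge0 ?modulus_ge0// ltW.
have [| |le2 t2] := @order_of_growth R psi (1 + B) _ _ psi_entire k0 s0.
- by rewrite lerDl.
- move=> z; rewrite (le_trans (HB z))//.
  apply: ler_pM => //; first by rewrite lerDr.
  by rewrite ler_expR; exact: growth_exponent.
case: ord => [|[ord2]]; first by rewrite ltNge le2.
by rewrite ltNge (t2 ord2).
Qed.

End WeightedComposition.

Theorem theorem3p1 (R : realType) (alpha : R) (p : \bar R)
    (a lambda : R[i]) (psi : R[i] -> R[i])
    (alpha_gt0 : 0 < alpha) (p_ge1 : (1%:E <= p)%E)
    (lambda_lt1 : modulus lambda < 1)
    (psi_entire : entire psi) (psi_neq0 : exists z : R[i], psi z <> 0) :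
  let phi := fun z : R[i] => a + lambda * z in
  let beta := 1 - modulus lambda ^+ 2 in
  let W := weighted_comp psi phi in
  ((entire_order psi < 2%:E)%E \/
   (entire_order psi = 2%:E /\ (entire_type psi < (alpha * beta / 2)%:E)%E) ->
     compact_operator (fock alpha p) (fock_norm alpha p) W /\
     compact_operator (fock0 alpha) (fock_norm alpha +oo%E) W) /\
  ((2%:E < entire_order psi)%E \/
   (entire_order psi = 2%:E /\ ((alpha * beta / 2)%:E < entire_type psi)%E) ->
     ~ bounded_operator (fock alpha p) (fock_norm alpha p) W /\
     ~ bounded_operator (fock0 alpha) (fock_norm alpha +oo%E) W).
Proof.
move=> phi beta W.
have k0 : 0 < alpha * beta / 2.
  rewrite divr_gt0// mulr_gt0// /beta subr_gt0 expr2.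
  by rewrite mulr_ilt1 ?modulus_ge0.
split => ord.
  have [t tk [C C0 HC]] := growth_of_order psi_entire k0 ord.
  have [d d0 [D D0 decay]] := weighted_comp_decay a alpha_gt0 tk C0 HC.
  split; first exact: (compact_weighted_comp alpha_gt0 psi_entire d0 D0 decay).
  exact: (compact0_weighted_comp alpha_gt0 psi_entire d0 D0 decay).
split.
  apply: (not_bounded alpha_gt0 psi_entire p_ge1 lambda_lt1 _ _ ord).
    by move=> f [].
  move=> w; split; first exact: entire_coherent.
  have a20 : 0 < alpha / 2 by rewrite divr_gt0.
  have [K _ HK] := fock_norm_le_gauss alpha_gt0 p_ge1 a20.
  have := HK _ w 1 (@entire_coherent R alpha w) ler01.
  move=> /(_ _)/le_lt_trans; apply; last exact: ltry.
  by move=> z; rewrite mul1r modulus_coherent.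
apply: (not_bounded alpha_gt0 psi_entire (leey _) lambda_lt1 _ _ ord).
  by move=> f [[]].
by move=> w; exact: fock0_coherent.
Qed.
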